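(* Let $W$ be an irreducible affine variety, let $z$ be the coordinate on $\mathbb{K}$, and let $f=\alpha z^k+1\in\mathbb{K}[W\times\mathbb{K}]$, where $k$ is a positive integer and $0\neq\alpha\in\mathbb{K}[W]$. Assume there exists a torus $T\subseteq\mathrm{Aut}(W\times\mathbb{K})$ such that $f$ is $T$-invariant. Assume also that $T$ cannot be included in a bigger torus $\widehat{T}\subseteq\mathrm{Aut}(W\times\mathbb{K})$ such that $f$ is $\widehat{T}$-semi-invariant with a nonzero weight. Then for any positive integers $m$ and $k_1,\dots,k_m$, the automorphism group $\mathrm{Aut}(X)$ of the variety $$X=\mathrm{Susp}(W\times\mathbb{K},f,1,k_1,\dots,k_m)\times\mathbb{K}$$ contains infinitely many pairwise non-conjugate (in $\mathrm{Aut}(X)$) maximal tori.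
   Context: $\mathbb{K}$ is an algebraically closed field of characteristic zero. For an affine variety $V$, a nonzero noninvertible $f\in\mathbb{K}[V]$ and positive integers $k_1,\dots,k_m$, the $m$-suspension is $\mathrm{Susp}(V,f,k_1,\dots,k_m)=\{y_1^{k_1}\cdots y_m^{k_m}=f\}\subseteq\mathbb{K}^m\times V$, where $y_1,\dots,y_m$ are coordinates on $\mathbb{K}^m$; thus $\mathrm{Susp}(V,f,1,k_1,\dots,k_m)=\{xy_1^{k_1}\cdots y_m^{k_m}=f\}\subseteq\mathbb{K}^{m+1}\times V$. A torus in $\mathrm{Aut}(X)$ (the group of regular automorphisms) is an algebraic subgroup isomorphic to $(\mathbb{K}^\times)^d$ for some $d\ge 0$ (the trivial torus is allowed); it is maximal if it is not properly contained in another torus in $\mathrm{Aut}(X)$. A regular function $f$ is semi-invariant with respect to a torus $T$ if $t\cdot f=\lambda(t)f$ for all $t\in T$, for a character $\lambda$ of $T$, called its weight; it is invariant if the weight is zero (the trivial character). *)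

(* Defs.v *)
From HB Require Import structures.
From mathcomp Require Import all_boot all_order all_algebra.
From mathcomp Require Import mpoly.

Set Implicit Arguments.
Unset Strict Implicit.
Unset Printing Implicit Defensive.

Import GRing.Theory.
Local Open Scope ring_scope.

(* An affine variety is a Zariski closed subset X of K^n, given by a predicate
   on row vectors; [pt X] is its set of points. *)

Definition zariski_closed (K : closedFieldType) (n : nat)
    (X : {pred 'rV[K]_n}) : Prop :=
  exists S : {mpoly K[n]} -> Prop,
    forall x : 'rV[K]_n, x \in X <-> (forall p, S p -> p.@[x 0] = 0).

Definition zariski_irreducible (K : closedFieldType) (n : nat)
    (X : {pred 'rV[K]_n}) : Prop :=
  (exists x, x \in X) /\
  forall A B : {pred 'rV[K]_n},
    zariski_closed A -> zariski_closed B ->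
    (forall x, x \in X -> x \in A \/ x \in B) ->
    (forall x, x \in X -> x \in A) \/ (forall x, x \in X -> x \in B).

Definition pt (K : closedFieldType) (n : nat) (X : {pred 'rV[K]_n}) : Type :=
  {x : 'rV[K]_n | x \in X}.

Definition regular_fun (K : closedFieldType) (n : nat) (X : {pred 'rV[K]_n})
    (f : pt X -> K) : Prop :=
  exists p : {mpoly K[n]}, forall x : pt X, f x = p.@[val x 0].

Definition regular_map (K : closedFieldType) (n p : nat)
    (X : {pred 'rV[K]_n}) (Y : {pred 'rV[K]_p}) (phi : pt X -> pt Y) : Prop :=
  forall j : 'I_p, regular_fun (fun x : pt X => val (phi x) 0 j).

Definition affine_line (K : closedFieldType) : {pred 'rV[K]_1} := predT.

Arguments affine_line K : clear implicits.

Definition prod_var (K : closedFieldType) (n p : nat)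
    (X : {pred 'rV[K]_n}) (Y : {pred 'rV[K]_p}) : {pred 'rV[K]_(n + p)} :=
  [pred u | (lsubmx u \in X) && (rsubmx u \in Y)].

Lemma prod_var_l (K : closedFieldType) (n p : nat)
    (X : {pred 'rV[K]_n}) (Y : {pred 'rV[K]_p}) (u : pt (prod_var X Y)) :
  lsubmx (val u) \in X.
Proof. by have /andP[] := valP u. Qed.

Lemma prod_var_r (K : closedFieldType) (n p : nat)
    (X : {pred 'rV[K]_n}) (Y : {pred 'rV[K]_p}) (u : pt (prod_var X Y)) :
  rsubmx (val u) \in Y.
Proof. by have /andP[] := valP u. Qed.

Definition proj_l (K : closedFieldType) (n p : nat)
    (X : {pred 'rV[K]_n}) (Y : {pred 'rV[K]_p}) (u : pt (prod_var X Y)) : pt X :=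
  exist _ (lsubmx (val u)) (prod_var_l u).

Definition proj_r (K : closedFieldType) (n p : nat)
    (X : {pred 'rV[K]_n}) (Y : {pred 'rV[K]_p}) (u : pt (prod_var X Y)) : pt Y :=
  exist _ (rsubmx (val u)) (prod_var_r u).

(* [insub] turns a vector of K^n lying in V into a point of V; vectors outside
   V are rejected. *)
Definition susp (K : closedFieldType) (n m : nat) (V : {pred 'rV[K]_n})
    (f : pt V -> K) (k : m.-tuple nat) : {pred 'rV[K]_(m + n)} :=
  [pred u | oapp (fun v : pt V => \prod_(i < m) lsubmx u 0 i ^+ tnth k i == f v)
                 false (insub (rsubmx u))].

Definition automorphism (K : closedFieldType) (n : nat) (X : {pred 'rV[K]_n})
    (phi : pt X -> pt X) : Prop :=
  exists psi : pt X -> pt X,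
    [/\ cancel phi psi, cancel psi phi, regular_map phi & regular_map psi].

(* The torus (K - 0)^d as the closed subvariety {(t, s) | t_i s_i = 1} of K^(d + d). *)
Definition Gm (K : closedFieldType) (d : nat) : {pred 'rV[K]_(d + d)} :=
  [pred u | [forall i, lsubmx u 0 i * rsubmx u 0 i == 1]].

Arguments Gm K d : clear implicits.

Lemma Gm_mul_subproof (K : closedFieldType) (d : nat) (s t : pt (Gm K d)) :
  (\row_i (val s 0 i * val t 0 i)) \in Gm K d.
Proof.
apply/forallP => i; rewrite !mxE mulrACA.
have /forallP/(_ i)/eqP := valP s; have /forallP/(_ i)/eqP := valP t.
by rewrite !mxE => -> ->; rewrite mulr1.
Qed.

Definition Gm_mul (K : closedFieldType) (d : nat) (s t : pt (Gm K d)) :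
    pt (Gm K d) :=
  exist _ (\row_i (val s 0 i * val t 0 i)) (Gm_mul_subproof s t).

(* [rho] is an isomorphism of Gm K d onto the subgroup T of Aut(X), T being
   algebraic: its algebraic structure, transported from Gm K d by [rho], makes
   the action T x X -> X a morphism. *)
Definition torus_iso (K : closedFieldType) (n d : nat) (X : {pred 'rV[K]_n})
    (T : (pt X -> pt X) -> Prop) (rho : pt (Gm K d) -> pt X -> pt X) : Prop :=
  [/\ forall t, automorphism (rho t),
      forall s t, rho (Gm_mul s t) = rho s \o rho t,
      injective rho,
      regular_map (fun u : pt (prod_var (Gm K d) X) => rho (proj_l u) (proj_r u))
    & forall phi, T phi <-> exists t, phi = rho t].

Definition torus (K : closedFieldType) (n : nat) (X : {pred 'rV[K]_n})
    (T : (pt X -> pt X) -> Prop) : Prop :=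
  exists (d : nat) (rho : pt (Gm K d) -> pt X -> pt X), torus_iso T rho.

Definition torus_sub (K : closedFieldType) (n : nat) (X : {pred 'rV[K]_n})
    (T1 T2 : (pt X -> pt X) -> Prop) : Prop :=
  forall phi, T1 phi -> T2 phi.

Definition torus_proper (K : closedFieldType) (n : nat) (X : {pred 'rV[K]_n})
    (T1 T2 : (pt X -> pt X) -> Prop) : Prop :=
  torus_sub T1 T2 /\ ~ torus_sub T2 T1.

Definition maximal_torus (K : closedFieldType) (n : nat) (X : {pred 'rV[K]_n})
    (T : (pt X -> pt X) -> Prop) : Prop :=
  torus T /\ ~ exists T', torus T' /\ torus_proper T T'.

(* T2 = g T1 g^-1 for some automorphism g, with h = g^-1. *)
Definition conjugate (K : closedFieldType) (n : nat) (X : {pred 'rV[K]_n})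
    (T1 T2 : (pt X -> pt X) -> Prop) : Prop :=
  exists g h : pt X -> pt X,
    [/\ automorphism g, cancel g h, cancel h g
      & forall phi, T2 phi <-> exists2 psi, T1 psi & phi = g \o psi \o h].

(* Only the values of [lambda] on T are relevant. *)
Definition character (K : closedFieldType) (n : nat) (X : {pred 'rV[K]_n})
    (T : (pt X -> pt X) -> Prop) (lambda : (pt X -> pt X) -> K) : Prop :=
  [/\ forall phi, T phi -> lambda phi != 0,
      forall phi psi, T phi -> T psi ->
        lambda (phi \o psi) = lambda phi * lambda psi
    & exists (d : nat) (rho : pt (Gm K d) -> pt X -> pt X),
        torus_iso T rho /\ regular_fun (fun t => lambda (rho t))].

Definition trivial_on (K : closedFieldType) (n : nat) (X : {pred 'rV[K]_n})
    (T : (pt X -> pt X) -> Prop) (lambda : (pt X -> pt X) -> K) : Prop :=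
  forall phi, T phi -> lambda phi = 1.

(* With (t . f)(x) = f (t^-1 x), the equality t . f = lambda(t) f is written
   here at the points t x. *)
Definition semi_invariant (K : closedFieldType) (n : nat) (X : {pred 'rV[K]_n})
    (T : (pt X -> pt X) -> Prop) (f : pt X -> K)
    (lambda : (pt X -> pt X) -> K) : Prop :=
  character T lambda /\
  forall phi, T phi -> forall x, f x = lambda phi * f (phi x).

Definition torus_invariant (K : closedFieldType) (n : nat) (X : {pred 'rV[K]_n})
    (T : (pt X -> pt X) -> Prop) (f : pt X -> K) : Prop :=
  exists2 lambda, semi_invariant T f lambda & trivial_on T lambda.

Definition alpha_zk_1 (K : closedFieldType) (n : nat) (W : {pred 'rV[K]_n})
    (alpha : pt W -> K) (k : nat) (v : pt (prod_var W (affine_line K))) : K :=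
  alpha (proj_l v) * val (proj_r v) 0 0 ^+ k + 1.

(* Main.v *)
Require Import Defs.
From HB Require Import structures.
From mathcomp Require Import all_boot all_order all_algebra.
From mathcomp Require Import cyclic separable cyclotomic mpoly.
From mathcomp Require Import ring zify.
From Stdlib Require Import Classical ClassicalChoice FunctionalExtensionality.

Set Implicit Arguments.
Unset Strict Implicit.
Unset Printing Implicit Defensive.

Import Order.TTheory GRing.Theory Num.Theory.
Local Open Scope ring_scope.

(** Write V for the product of W with the line, z for the coordinate on the
    line and f = alpha z^k + 1, and for an exponent N let Z_N be the product of
    the hypersurface x (y_1 ... y_m)^N = f(v) with a line with coordinate u.

    All the Z_N are isomorphic to X, by the argument of Danielewski
    ([danielewski]): z f_z is the constant - k modulo f, so that changing the
    exponents of the y_i only changes the coordinate z along the orbits of a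
    free action of the additive group. Explicitly, an approximate root
    z (1 - f)^(-1/k) of f is used, where the power is a truncated binomial
    series in f.

    Let T_1 be a torus of largest dimension among the tori that contain T and
    leave f invariant; it exists because a torus of automorphisms of V has
    dimension at most the number of coordinates ([torus_dim_le]). On Z_N acts
    the torus TZ generated by T_1, the scalings of the y_i (with the inverse
    scaling of x) and the scaling of u. It is maximal ([TZ_maximal]): a torus
    containing it commutes with the scalings, hence acts on V and multiplies
    y_i and u by nowhere vanishing functions on V, which are characters since
    they are regular on the torus and V has no zero divisors
    ([character_family]). The torus induced on V then multiplies f by a
    character, so by the choice of T_1 it is T_1.

    The tori obtained in Aut(X) for different N are distinguished by the
    component groups of the stabilizers of points. For each torus some positive
    e kills all of these groups ([stabilizer_exponent_exists]), whereas for the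
    torus on Z_N such an e is a multiple of N
    ([stabilizer_exponent_dvd]), because of the points where only y_1 vanishes.
    So a sequence of exponents N, each exceeding the numbers e chosen for the
    earlier ones, gives pairwise non-conjugate tori.

    Everything about tori rests on the weight decomposition: a regular action
    of a torus is described by finitely many eigenfunctions and an integer
    matrix of weights ([eigen_coordinates_exist]), which reduces statements on
    subgroups and quotients of tori to integer linear algebra. *)

(** * Regular functions *)

Section RegularFunctions.
Variables (K : closedFieldType) (n : nat) (X : {pred 'rV[K]_n}).
Implicit Types f g : pt X -> K.

Lemma pt_ext (p q : pt X) : (forall j, val p 0 j = val q 0 j) -> p = q.
Proof. by move=> pq; apply/val_inj/rowP. Qed.

Lemma reg_ext f g : regular_fun f -> (forall p, g p = f p) -> regular_fun g.
Proof. by case=> P fP gf; exists P => p; rewrite gf. Qed.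

Lemma reg_cst c : regular_fun (fun _ : pt X => c).
Proof. by exists c%:MP => p; rewrite mevalC. Qed.

Lemma reg_coord j : regular_fun (fun p : pt X => val p 0 j).
Proof. by exists 'X_j => p; rewrite mevalXU. Qed.

Lemma regD f g :
  regular_fun f -> regular_fun g -> regular_fun (fun p => f p + g p).
Proof. by case=> P fP [Q gQ]; exists (P + Q) => p; rewrite mevalD fP gQ. Qed.

Lemma regN f : regular_fun f -> regular_fun (fun p => - f p).
Proof. by case=> P fP; exists (- P) => p; rewrite mevalN fP. Qed.

Lemma regB f g :
  regular_fun f -> regular_fun g -> regular_fun (fun p => f p - g p).
Proof. by move=> rf rg; apply: regD => //; apply: regN. Qed.

Lemma regM f g :
  regular_fun f -> regular_fun g -> regular_fun (fun p => f p * g p).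
Proof. by case=> P fP [Q gQ]; exists (P * Q) => p; rewrite mevalM fP gQ. Qed.

Lemma regX f i : regular_fun f -> regular_fun (fun p => f p ^+ i).
Proof.
move=> rf; elim: i => [|i IHi]; first exact: reg_cst.
by apply: (reg_ext (regM rf IHi)) => p; rewrite exprS.
Qed.

Lemma reg_sum (I : Type) (s : seq I) (Q : pred I) (F : I -> pt X -> K) :
  (forall i, Q i -> regular_fun (F i)) ->
  regular_fun (fun p => \sum_(i <- s | Q i) F i p).
Proof.
move=> rF; elim: s => [|i s IHs].
  by apply: (reg_ext (reg_cst 0)) => p; rewrite big_nil.
case Qi: (Q i).
  by apply: (reg_ext (regD (rF i Qi) IHs)) => p; rewrite big_cons Qi.
by apply: (reg_ext IHs) => p; rewrite big_cons Qi.
Qed.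

Lemma reg_prod (I : Type) (s : seq I) (Q : pred I) (F : I -> pt X -> K) :
  (forall i, Q i -> regular_fun (F i)) ->
  regular_fun (fun p => \prod_(i <- s | Q i) F i p).
Proof.
move=> rF; elim: s => [|i s IHs].
  by apply: (reg_ext (reg_cst 1)) => p; rewrite big_nil.
case Qi: (Q i).
  by apply: (reg_ext (regM (rF i Qi) IHs)) => p; rewrite big_cons Qi.
by apply: (reg_ext IHs) => p; rewrite big_cons Qi.
Qed.

Lemma reg_horner (u : {poly K}) f :
  regular_fun f -> regular_fun (fun p => u.[f p]).
Proof.
move=> rf; apply: (@reg_ext (fun p => \sum_(i < size u) u`_i * f p ^+ i)).
  by apply: reg_sum => i _; apply: regM; [exact: reg_cst | exact: regX].
by move=> p; rewrite horner_coef.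
Qed.

End RegularFunctions.

Section RegularMaps.
Variable K : closedFieldType.

Lemma reg_comp n p (X : {pred 'rV[K]_n}) (Y : {pred 'rV[K]_p})
    (phi : pt X -> pt Y) (f : pt Y -> K) :
  regular_map phi -> regular_fun f -> regular_fun (fun x => f (phi x)).
Proof.
move=> rphi [P fP].
apply: (@reg_ext _ _ _ (fun x => P.@[val (phi x) 0])) => {fP}//.
apply: (@reg_ext _ _ _ (fun x =>
  \sum_(m <- msupp P) P@_m * \prod_i val (phi x) 0 i ^+ m i)); last first.
  by move=> x; rewrite mevalE.
apply: reg_sum => m _; apply: regM; first exact: reg_cst.
by apply: reg_prod => i _; apply: regX; apply: rphi.
Qed.

Lemma regmap_id n (X : {pred 'rV[K]_n}) : regular_map (@id (pt X)).
Proof. by move=> j; apply: reg_coord. Qed.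

Lemma regmap_cst n p (X : {pred 'rV[K]_n}) (Y : {pred 'rV[K]_p}) (y : pt Y) :
  regular_map (fun _ : pt X => y).
Proof. by move=> j; apply: reg_cst. Qed.

Lemma regmap_comp n p q (X : {pred 'rV[K]_n}) (Y : {pred 'rV[K]_p})
    (Z : {pred 'rV[K]_q}) (phi : pt X -> pt Y) (psi : pt Y -> pt Z) :
  regular_map phi -> regular_map psi -> regular_map (fun x => psi (phi x)).
Proof. by move=> rphi rpsi j; apply: (reg_comp rphi (rpsi j)). Qed.

Variables (n p : nat) (X : {pred 'rV[K]_n}) (Y : {pred 'rV[K]_p}).

Lemma pair_subproof (x : pt X) (y : pt Y) :
  row_mx (val x) (val y) \in prod_var X Y.
Proof. by rewrite inE row_mxKl row_mxKr (valP x) (valP y). Qed.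

Definition pair_pt (x : pt X) (y : pt Y) : pt (prod_var X Y) :=
  exist _ (row_mx (val x) (val y)) (pair_subproof x y).

Lemma pair_ptKl x y : proj_l (pair_pt x y) = x.
Proof. by apply: val_inj; rewrite /= row_mxKl. Qed.

Lemma pair_ptKr x y : proj_r (pair_pt x y) = y.
Proof. by apply: val_inj; rewrite /= row_mxKr. Qed.

Lemma pair_ptE u : u = pair_pt (proj_l u) (proj_r u).
Proof. by apply: val_inj; rewrite /= hsubmxK. Qed.

Lemma prod_ext (u v : pt (prod_var X Y)) :
  proj_l u = proj_l v -> proj_r u = proj_r v -> u = v.
Proof. by move=> ul ur; rewrite (pair_ptE u) (pair_ptE v) ul ur. Qed.

Lemma regmap_l : regular_map (@proj_l K n p X Y).
Proof.
by move=> j; apply: (reg_ext (reg_coord _ (lshift p j))) => u; rewrite mxE.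
Qed.

Lemma regmap_r : regular_map (@proj_r K n p X Y).
Proof.
by move=> j; apply: (reg_ext (reg_coord _ (rshift n j))) => u; rewrite mxE.
Qed.

Lemma regmap_pair q (Z : {pred 'rV[K]_q}) (phi : pt Z -> pt X)
    (psi : pt Z -> pt Y) :
  regular_map phi -> regular_map psi ->
  regular_map (fun z => pair_pt (phi z) (psi z)).
Proof.
move=> rphi rpsi j; case: (split_ordP j) => i ->.
  by apply: (reg_ext (rphi i)) => z; rewrite row_mxEl.
by apply: (reg_ext (rpsi i)) => z; rewrite row_mxEr.
Qed.

End RegularMaps.
Arguments regmap_id {K n} X.
Arguments regmap_cst {K n p X Y} y.
Arguments regmap_l {K n p} X Y.
Arguments regmap_r {K n p} X Y.

(** * Points of the split torus and their weights *)

Section TorusPoints.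
Variable K : closedFieldType.

Definition gmv d (t : pt (Gm K d)) (i : 'I_d) : K := val t 0 (lshift d i).

Lemma gmv_neq0 d (t : pt (Gm K d)) i : gmv t i != 0.
Proof.
have /forallP/(_ i) := valP t; rewrite !mxE -/(gmv t i).
by apply: contraTneq => ->; rewrite mul0r eq_sym oner_neq0.
Qed.

Lemma gmv_inv d (t : pt (Gm K d)) i : val t 0 (rshift d i) = (gmv t i)^-1.
Proof.
have /forallP/(_ i)/eqP := valP t; rewrite !mxE -/(gmv t i) => ts1.
by apply: (mulfI (gmv_neq0 t i)); rewrite ts1 divff ?gmv_neq0.
Qed.

Lemma gm_ext d (s t : pt (Gm K d)) : (forall i, gmv s i = gmv t i) -> s = t.
Proof.
move=> st; apply: pt_ext => j; case: (split_ordP j) => i ->; first exact: st.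
by rewrite !gmv_inv st.
Qed.

Definition mkgm_row d (a : 'I_d -> K) : 'rV[K]_(d + d) :=
  row_mx (\row_i (if a i == 0 then 1 else a i))
         (\row_i (if a i == 0 then 1 else a i)^-1).

Lemma mkgm_subproof d (a : 'I_d -> K) : mkgm_row a \in Gm K d.
Proof.
apply/forallP => i; rewrite row_mxKl row_mxKr !mxE.
by case: ifPn => [_|a0]; rewrite ?invr1 ?mulr1 ?divff.
Qed.

(** Zero entries are replaced by 1, so that any family of scalars yields a
    point of the torus. *)
Definition mkgm d (a : 'I_d -> K) : pt (Gm K d) :=
  exist _ (mkgm_row a) (mkgm_subproof a).

Lemma mkgmE d (a : 'I_d -> K) i : a i != 0 -> gmv (mkgm a) i = a i.
Proof. by rewrite /gmv /= row_mxEl mxE => /negPf ->. Qed.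

Lemma gmvM d (s t : pt (Gm K d)) i : gmv (Gm_mul s t) i = gmv s i * gmv t i.
Proof. by rewrite /gmv /= mxE. Qed.

Definition gm1 d : pt (Gm K d) := mkgm (fun _ => 1).

Lemma gmv1 d i : gmv (gm1 d) i = 1.
Proof. by rewrite mkgmE ?oner_neq0. Qed.

Lemma reg_gmv d i : regular_fun (fun t : pt (Gm K d) => gmv t i).
Proof. exact: reg_coord. Qed.

Definition wt d (t : pt (Gm K d)) (w : 'rV[int]_d) : K :=
  \prod_i gmv t i ^ w 0 i.

Lemma wt_neq0 d (t : pt (Gm K d)) w : wt t w != 0.
Proof. by apply/prodf_neq0 => i _; rewrite expfz_neq0 ?gmv_neq0. Qed.

Lemma wtD d (t : pt (Gm K d)) w1 w2 : wt t (w1 + w2) = wt t w1 * wt t w2.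
Proof.
by rewrite -big_split; apply: eq_bigr => i _; rewrite mxE expfzDr ?gmv_neq0.
Qed.

Lemma wt0 d (t : pt (Gm K d)) : wt t 0 = 1.
Proof. by rewrite /wt big1 // => i _; rewrite mxE expr0z. Qed.

Lemma wtZ d (t : pt (Gm K d)) (c : int) w : wt t (c *: w) = wt t w ^ c.
Proof.
have expprod (I : eqType) (s : seq I) (F : I -> K) :
    (\prod_(i <- s) F i) ^ c = \prod_(i <- s) F i ^ c.
  elim: s => [|i s IHs]; first by rewrite !big_nil exp1rz.
  by rewrite !big_cons expfzMl IHs.
rewrite /wt expprod; apply: eq_bigr => i _.
by rewrite mxE exprzAC exprz_exp.
Qed.

Lemma wt_sum d (t : pt (Gm K d)) (I : Type) (s : seq I) (F : I -> 'rV[int]_d) :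
  wt t (\sum_(i <- s) F i) = \prod_(i <- s) wt t (F i).
Proof. by rewrite (big_morph (wt t) (wtD t) (wt0 t)). Qed.

Lemma wt_delta d (t : pt (Gm K d)) i : wt t (delta_mx 0 i) = gmv t i.
Proof.
rewrite /wt (bigD1 i) //= mxE !eqxx expr1z big1 ?mulr1 // => j ji.
by rewrite mxE eqxx (negPf ji) expr0z.
Qed.

Lemma wtM d (s t : pt (Gm K d)) w : wt (Gm_mul s t) w = wt s w * wt t w.
Proof. by rewrite -big_split; apply: eq_bigr => i _; rewrite gmvM expfzMl. Qed.

Lemma wt1 d w : wt (gm1 d) w = 1.
Proof. by rewrite /wt big1 // => i _; rewrite gmv1 exp1rz. Qed.

Lemma reg_wt d w : regular_fun (fun t : pt (Gm K d) => wt t w).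
Proof.
apply: reg_prod => i _; case: (w 0 i) => a; first exact/regX/reg_gmv.
apply: (reg_ext (regX a.+1 (reg_coord _ (rshift d i)))) => t.
by rewrite gmv_inv NegzE exprVn.
Qed.

(** The homomorphism of tori given by an integer matrix; pulling back a
    character by it multiplies the weight by the matrix. *)
Definition gmpow d e (M : 'M[int]_(e, d)) (t : pt (Gm K d)) : pt (Gm K e) :=
  mkgm (fun i => wt t (row i M)).

Lemma gmv_pow d e (M : 'M[int]_(e, d)) t i :
  gmv (gmpow M t) i = wt t (row i M).
Proof. by rewrite mkgmE ?wt_neq0. Qed.

Lemma wt_pow d e (M : 'M[int]_(e, d)) t w : wt (gmpow M t) w = wt t (w *m M).
Proof.
rewrite mulmx_sum_row wt_sum; apply: eq_bigr => i _.
by rewrite gmv_pow wtZ.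
Qed.

Lemma gmpowM d e f (M : 'M[int]_(e, d)) (N : 'M[int]_(f, e)) t :
  gmpow N (gmpow M t) = gmpow (N *m M) t.
Proof. by apply: gm_ext => i; rewrite !gmv_pow wt_pow row_mul. Qed.

Lemma gmpow_id d (t : pt (Gm K d)) : gmpow 1%:M t = t.
Proof. by apply: gm_ext => i; rewrite gmv_pow row1 wt_delta. Qed.

Lemma gmpow_mul d e (M : 'M[int]_(e, d)) s t :
  gmpow M (Gm_mul s t) = Gm_mul (gmpow M s) (gmpow M t).
Proof. by apply: gm_ext => i; rewrite gmvM !gmv_pow wtM. Qed.

Lemma gmpowD d e (M N : 'M[int]_(e, d)) t :
  gmpow (M + N) t = Gm_mul (gmpow M t) (gmpow N t).
Proof. by apply: gm_ext => i; rewrite gmvM !gmv_pow linearD wtD. Qed.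

Lemma gmpow0 d e (t : pt (Gm K d)) : gmpow (0 : 'M_(e, d)) t = gm1 e.
Proof. by apply: gm_ext => i; rewrite gmv_pow gmv1 row0 wt0. Qed.

Lemma gmpow1 d e (M : 'M[int]_(e, d)) : gmpow M (gm1 d) = gm1 e.
Proof. by apply: gm_ext => i; rewrite gmv_pow gmv1 wt1. Qed.

Lemma gmv_scal d (c : int) (t : pt (Gm K d)) i :
  gmv (gmpow c%:M t) i = gmv t i ^ c.
Proof. by rewrite gmv_pow -scalemx1 linearZ /= row1 wtZ wt_delta. Qed.

Lemma Gm_mulC d (s t : pt (Gm K d)) : Gm_mul s t = Gm_mul t s.
Proof. by apply: gm_ext => i; rewrite !gmvM mulrC. Qed.

Lemma Gm_mul1 d (t : pt (Gm K d)) : Gm_mul (gm1 d) t = t.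
Proof. by apply: gm_ext => i; rewrite gmvM gmv1 mul1r. Qed.

Lemma regmap_gm n d (X : {pred 'rV[K]_n}) (phi : pt X -> pt (Gm K d)) :
  (forall i, regular_fun (fun x => gmv (phi x) i)) ->
  (forall i, regular_fun (fun x => (gmv (phi x) i)^-1)) -> regular_map phi.
Proof.
move=> r1 r2 j; case: (split_ordP j) => i ->; first exact: r1.
by apply: (reg_ext (r2 i)) => x; rewrite gmv_inv.
Qed.

Lemma regmap_pow d e (M : 'M[int]_(e, d)) : regular_map (@gmpow d e M).
Proof.
apply: regmap_gm => i.
  by apply: (reg_ext (reg_wt _)) => t; rewrite gmv_pow.
apply: (reg_ext (reg_wt ((-1) *: row i M))) => t.
by rewrite gmv_pow wtZ exprN1.
Qed.

End TorusPoints.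
Arguments reg_wt {K d} w.
Arguments reg_gmv {K d} i.
Arguments regmap_pow {K d e} M.

Lemma closed_root (K : closedFieldType) (a : K) q :
  (0 < q)%N -> exists b, b ^+ q = a.
Proof.
move=> q0; have [b] := solve_monicpoly (fun i => if i == 0%N then a else 0) q0.
rewrite -(prednK q0) big_ord_recl big1 ?addr0 /= ?mulr1; last first.
  by move=> i _; rewrite mul0r.
by rewrite prednK // => bq; exists b.
Qed.

(** Tori over an algebraically closed field are divisible groups. *)
Lemma gm_root (K : closedFieldType) d (t : pt (Gm K d)) (q : nat) :
  (0 < q)%N -> exists s, gmpow (q%:Z)%:M s = t.
Proof.
move=> q0; have [b bE] := choice _ (fun i => closed_root (gmv t i) q0).
have b0 i : b i != 0.
  by apply: contraNneq (gmv_neq0 t i) => b0; rewrite -bE b0 expr0n eqn0Ngt q0.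
by exists (mkgm b); apply: gm_ext => i; rewrite gmv_scal mkgmE // -exprnP bE.
Qed.

(** * Independence of characters *)

Lemma natural_nonroot (R : idomainType) (p : {poly R}) :
  injective (fun i : nat => i%:R : R) -> p != 0 -> exists i : nat, ~~ root p i%:R.
Proof.
move=> natr_inj p0; apply: NNPP => noi.
have roots : all (root p) [seq i%:R | i <- iota 0 (size p)].
  apply/allP => _ /mapP[i _ ->]; case pi: (root p i%:R) => //.
  by case: noi; exists i; rewrite pi.
have := max_poly_roots p0 roots; rewrite map_inj_uniq ?iota_uniq // size_map.
by rewrite size_iota ltnn => /(_ isT).
Qed.

Lemma natr_inj_pchar0 (R : idomainType) :
  [pchar R] =i pred0 -> injective (fun i : nat => i%:R : R).
Proof.
move/pcharf0P => R0.
have le_inj i j : (i <= j)%N -> i%:R = j%:R :> R -> i = j.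
  move=> ij /eqP; rewrite eq_sym -subr_eq0 -natrB // R0 subn_eq0 => ji.
  by apply/eqP; rewrite eqn_leq ij ji.
by move=> i j; case/orP: (leq_total i j) => ij e; [|symmetry]; apply: le_inj.
Qed.

Lemma nonzero_nonroot (K : closedFieldType) (p : {poly K}) :
  [pchar K] =i pred0 -> p != 0 -> exists2 t : K, t != 0 & p.[t] != 0.
Proof.
move=> K0 p0; have pX0 : p * 'X != 0 by rewrite mulf_neq0 ?polyX_eq0.
have [i] := natural_nonroot (natr_inj_pchar0 K0) pX0.
by rewrite rootM rootX negb_or => /andP[pi i0]; exists i%:R.
Qed.

Section Characters.
Variables (K : closedFieldType) (charK0 : [pchar K] =i pred0).

(** Along the cocharacter c, c^b, c^(b^2), ... a difference of weights becomes
    the value at b of the polynomial whose coefficients are its entries, and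
    finitely many nonzero integer polynomials have a common natural non-root. *)
Lemma separating_cocharacter d (ws : seq 'rV[int]_d) :
  exists v : 'cV[int]_d, {in ws &, injective (fun w => (w *m v) 0 0)}.
Proof.
pose Q := \prod_(u <- [seq (w1, w2) | w1 <- ws, w2 <- ws] | u.1 != u.2)
            rVpoly (u.1 - u.2) : {poly int}.
have Q0 : Q != 0.
  rewrite prodf_seq_neq0; apply/allP => u _; apply/implyP; apply: contraNneq.
  by move=> u0; rewrite -subr_eq0 -[_ - _]rVpolyK u0 linear0.
have int_inj : injective (fun i : nat => i%:R : int).
  by move=> i j /eqP; rewrite eqr_nat => /eqP.
have [b] := natural_nonroot int_inj Q0.
rewrite rootE horner_prod prodf_seq_neq0 => /allP nzb.
exists (\col_i b%:R ^+ i) => w1 w2 w1s w2s /eqP.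
rewrite -subr_eq0 => wb; apply: contraTeq wb => w12.
have /implyP/(_ w12) := nzb (w1, w2) (allpairs_f _ w1s w2s).
congr (_ != 0); rewrite /rVpoly horner_poly /= !mxE -sumrB.
by apply: eq_bigr => i _; rewrite valK !mxE mulrBl.
Qed.

(** Along a cocharacter separating the weights, a Laurent polynomial becomes,
    up to a power of the variable, a polynomial in one variable with the same
    coefficients. *)
Lemma laurent_specialize d (ws : seq 'rV[int]_d) (a : 'rV[int]_d -> K) :
  exists (e : 'rV[int]_d -> nat) (M : nat) (v : 'cV[int]_d),
    {in ws &, injective e} /\ forall c : K, c != 0 ->
      (\sum_(w <- ws) a w *: 'X^(e w)).[c] =
      c ^+ M * \sum_(w <- ws) a w * wt (gmpow v (mkgm (fun=> c))) w.
Proof.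
have [v v_inj] := separating_cocharacter ws.
pose N (w : 'rV[int]_d) : int := (w *m v) 0 0.
pose M := (\sum_(w <- ws) `|N w|)%N.
have NM w : w \in ws -> 0 <= N w + M%:Z.
  move=> ws_w; have : (`|N w| <= M)%N by rewrite /M (big_rem w) //= leq_addr.
  lia.
pose e w := absz (N w + M%:Z).
have eE w : w \in ws -> (e w)%:Z = N w + M%:Z by move=> /NM; rewrite /e; lia.
exists e, M, v; split=> [w1 w2 s1 s2 e12|c c0].
  by apply: v_inj => //; apply: (addIr M%:Z); rewrite -!eE ?e12.
rewrite horner_sum mulr_sumr big_seq [RHS]big_seq; apply: eq_bigr => w ws_w.
rewrite hornerZ hornerXn mulrCA; congr (_ * _).
rewrite [c ^+ e w]exprnP eE // expfzDr // mulrC -exprnP; congr (_ * _).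
rewrite wt_pow /wt big_ord1 mkgmE //.
Qed.

Lemma laurent_coef d (ws : seq 'rV[int]_d) (a : 'rV[int]_d -> K) e w0 :
  uniq ws -> {in ws &, injective e} -> w0 \in ws ->
  (\sum_(w <- ws) a w *: 'X^(e w))`_(e w0) = a w0.
Proof.
move=> ws_uniq e_inj ws0; rewrite coef_sum (bigD1_seq w0) //=.
rewrite coefZ coefXn eqxx mulr1 big_seq_cond big1 ?addr0 // => w /andP[ws_w ww0].
rewrite coefZ coefXn; case: eqP => [e0|_]; last by rewrite mulr0.
by rewrite (e_inj w w0) ?eqxx in ww0.
Qed.

Lemma characters_indep d (ws : seq 'rV[int]_d) (a : 'rV[int]_d -> K) :
  uniq ws -> (forall t, \sum_(w <- ws) a w * wt t w = 0) ->
  {in ws, forall w, a w = 0}.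
Proof.
move=> ws_uniq a0 w0 ws0; have [e [M [v [e_inj eE]]]] := laurent_specialize ws a.
rewrite -(laurent_coef a ws_uniq e_inj ws0).
set p := \sum_(w <- ws) _ in eE *.
have [->|p0] := eqVneq p 0; first by rewrite coef0.
have [c c0] := nonzero_nonroot charK0 p0.
by rewrite eE // a0 mulr0 eqxx.
Qed.

Lemma nonvanishing_poly (p : {poly K}) :
  (forall c, c != 0 -> p.[c] != 0) -> exists2 i, p`_i != 0 & p = p`_i *: 'X^i.
Proof.
move=> nz; have p0 : p != 0.
  by apply: contraNneq (nz 1 (oner_neq0 _)) => ->; rewrite horner0.
have [i [q q0 pE]] := multiplicity_XsubC p 0.
move: q0; rewrite p0 /= rootE => q0.
have q1 : size q == 1%N.
  apply: contraT => /closed_rootP[c qc].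
  have [c0|c0] := eqVneq c 0; first by rewrite c0 /root in qc; rewrite qc in q0.
  by move: (nz c c0); rewrite pE hornerM (rootP qc) mul0r eqxx.
have [b b0 qb] := size_poly1P _ q1.
have pi : p`_i = b.
  by rewrite pE qb subr0 coefCM coefXn eqxx mulr1.
by exists i; rewrite pi // pE qb subr0 mul_polyC.
Qed.

(** Specialized along a separating cocharacter, the Laurent polynomial has no
    root besides 0 in an algebraically closed field, hence is a monomial. *)
Lemma nonvanishing_laurent d (ws : seq 'rV[int]_d) (a : 'rV[int]_d -> K) :
  uniq ws -> (forall t, \sum_(w <- ws) a w * wt t w != 0) ->
  exists2 w0, w0 \in ws & {in ws, forall w, w != w0 -> a w = 0}.
Proof.
move=> ws_uniq nz; have [e [M [v [e_inj eE]]]] := laurent_specialize ws a.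
have coefE := laurent_coef a ws_uniq e_inj.
set p := \sum_(w <- ws) _ in eE coefE.
have [c c0|i pi0 pE] := @nonvanishing_poly p.
  by rewrite eE // mulf_neq0 ?expf_neq0.
have ai w : w \in ws -> e w != i -> a w = 0.
  by move=> ws_w ewi; rewrite -coefE // pE coefZ coefXn (negPf ewi) mulr0.
have [[w0 ws0 ew0]|noi] := altP (@hasP _ (fun w => e w == i) ws).
  exists w0 => // w ws_w ww0; apply: ai => //; apply: contraNneq ww0 => ew.
  by apply/eqP/e_inj; rewrite // ew (eqP ew0).
case/negP: (nz (gm1 K d)); apply/eqP; rewrite big_seq big1 // => w ws_w.
rewrite ai ?mul0r //; apply: contraNneq noi => ew.
by apply/hasP; exists w => //; apply/eqP.
Qed.

End Characters.

(** * Eigenfunctions of torus actions *)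

Section Eigenfunctions.
Variables (K : closedFieldType) (charK0 : [pchar K] =i pred0).

Lemma sum_fibers (A : nmodType) (I : Type) (J : eqType) (s : seq I) (js : seq J)
    (c : I -> J) (F : I -> A) :
  uniq js -> all (fun i => c i \in js) s ->
  \sum_(i <- s) F i = \sum_(j <- js) \sum_(i <- s | c i == j) F i.
Proof.
move=> js_uniq; elim: s => [_|i s IHs /= /andP[ci cs]].
  by rewrite big_nil big1 // => j _; rewrite big_nil.
rewrite big_cons IHs // [RHS](eq_bigr (fun j =>
  (if c i == j then F i else 0) + \sum_(i <- s | c i == j) F i)); last first.
  by move=> j _; rewrite big_cons; case: ifP; rewrite ?add0r.
rewrite big_split /=; congr (_ + _); rewrite (bigD1_seq (c i)) //= eqxx big1 ?addr0 // => j.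
by rewrite eq_sym => /negPf ->.
Qed.

(** On the torus the second half of the coordinates are the inverses of the
    first half, so that polynomials restrict to Laurent polynomials. *)
Lemma laurent_expansion d n (X : {pred 'rV[K]_n})
    (F : pt (prod_var (Gm K d) X) -> K) :
  regular_fun F ->
  exists (ws : seq 'rV[int]_d) (h : 'rV[int]_d -> pt X -> K),
    [/\ uniq ws, forall w, regular_fun (h w)
      & forall t p, F (pair_pt t p) = \sum_(w <- ws) h w p * wt t w].
Proof.
case=> P FP.
pose c (m : 'X_{1..(d + d) + n}) : 'rV[int]_d :=
  \row_i ((m (lshift n (lshift d i)))%:Z - (m (lshift n (rshift d i)))%:Z).
pose term (m : 'X_{1..(d + d) + n}) (p : pt X) :=
  P@_m * \prod_(i < n) val p 0 i ^+ m (rshift (d + d) i).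
exists (undup (map c (msupp P))), (fun w p => \sum_(m <- msupp P | c m == w) term m p).
split=> [|w|t p]; first exact: undup_uniq.
  apply: reg_sum => m _; apply: regM; first exact: reg_cst.
  by apply: reg_prod => i _; apply/regX/reg_coord.
rewrite FP mevalE (@sum_fibers _ _ _ _ (undup (map c (msupp P))) c); last first.
- by apply/allP => m m_P; rewrite mem_undup map_f.
- exact: undup_uniq.
apply: eq_bigr => w _; rewrite mulr_suml; apply: eq_bigr => m /eqP <-.
rewrite /term -mulrA; congr (_ * _).
rewrite big_split_ord mulrC /=; congr (_ * _); last first.
  by apply: eq_bigr => i _; rewrite row_mxEr.
rewrite big_split_ord /= -big_split; apply: eq_bigr => i _ /=.
rewrite !row_mxEl gmv_inv mxE -/(gmv t i) expfzDr ?gmv_neq0 //.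
by rewrite -exprnP -exprnN exprVn.
Qed.

Variables (d n : nat) (X : {pred 'rV[K]_n}).

Record regular_action (rho : pt (Gm K d) -> pt X -> pt X) : Prop := {
  action_mul : forall s t p, rho (Gm_mul s t) p = rho s (rho t p);
  action_one : forall p, rho (gm1 K d) p = p;
  action_reg :
    regular_map (fun u : pt (prod_var (Gm K d) X) => rho (proj_l u) (proj_r u)) }.

(** The g_i span a space of functions containing the coordinates of the affine
    space around X, and the action multiplies g_i by the character given by
    the i-th row of [chi]: these data determine the action. *)
Record eigen_coordinates (rho : pt (Gm K d) -> pt X -> pt X) (q : nat)
    (chi : 'M[int]_(q, d)) (g : 'I_q -> pt X -> K) (A : 'M[K]_(n, q)) : Prop := {
  eigen_reg : forall i, regular_fun (g i);
  eigen_neq0 : forall i, exists p, g i p != 0;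
  eigen_wt : forall t p i, g i (rho t p) = wt t (row i chi) * g i p;
  eigen_coord : forall (p : pt X) j, val p 0 j = \sum_i A j i * g i p }.

(** The g_i are the coefficients in the Laurent expansions of the functions
    (t, p) |-> val (rho t p) 0 j; that they are eigenfunctions follows by
    comparing the expansions of rho (s t) p and rho s (rho t p) in s. *)
Lemma eigen_coordinates_exist rho :
  regular_action rho -> exists q chi g A, @eigen_coordinates rho q chi g A.
Proof.
move=> act.
have expand (j : 'I_n) : exists (ws : seq 'rV[int]_d) (h : 'rV[int]_d -> pt X -> K),
    [/\ uniq ws, forall w, regular_fun (h w)
      & forall t p, val (rho t p) 0 j = \sum_(w <- ws) h w p * wt t w].
  have [ws [h [ws_uniq h_reg hE]]] := laurent_expansion (action_reg act j).
  by exists ws, h; split=> // t p; rewrite -hE pair_ptKl pair_ptKr.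
have [ws wsP] := choice _ expand; have {wsP}[h hP] := choice _ wsP.
have h_reg j w : regular_fun (h j w) by have [] := hP j.
have h_wt j w t p : w \in ws j -> h j w (rho t p) = wt t w * h j w p.
  have [ws_uniq _ hE] := hP j.
  pose a w := h j w (rho t p) - wt t w * h j w p.
  have a0 s : \sum_(w <- ws j) a w * wt s w = 0.
    rewrite (eq_bigr (fun w =>
      h j w (rho t p) * wt s w - h j w p * wt (Gm_mul s t) w)).
      by rewrite sumrB -!hE (action_mul act) subrr.
    by move=> w' _; rewrite /a mulrBl wtM; congr (_ - _); ring.
  move=> /(characters_indep charK0 ws_uniq a0)/eqP.
  by rewrite subr_eq0 => /eqP.
have h_coord j (p : pt X) : val p 0 j = \sum_(w <- ws j) h j w p.
  have [_ _ hE] := hP j; rewrite -[in LHS](action_one act p) hE.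
  by apply: eq_bigr => w _; rewrite wt1 mulr1.
(* Only coefficients that do not vanish identically are weights of the action. *)
have decide (u : 'I_n * 'rV[int]_d) :
    exists b : bool, b <-> exists p, h u.1 u.2 p != 0.
  case: (classic (exists p, h u.1 u.2 p != 0)) => hu.
    by exists true.
  by exists false.
have [b bP] := choice _ decide.
pose S := [seq u <- [seq (j, w) | j <- enum 'I_n, w <- ws j] | b u].
have SP (i : 'I_(size S)) : let u := tnth (in_tuple S) i in
    u.2 \in ws u.1 /\ exists p, h u.1 u.2 p != 0.
  have := mem_tnth i (in_tuple S); rewrite mem_filter => /andP[/bP nz].
  by case/allpairsPdep => j [w [_ ws_w uE]]; rewrite uE in nz *.
pose u i := tnth (in_tuple S) i.
exists (size S), (\matrix_i (u i).2), (fun i => h (u i).1 (u i).2),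
  (\matrix_(j, i) ((u i).1 == j)%:R); split=> [i|i|t p i|p j].
- exact: h_reg.
- by have [] := SP i.
- by rewrite rowK h_wt //; have [] := SP i.
rewrite h_coord.
transitivity (\sum_(v <- S) (v.1 == j)%:R * h v.1 v.2 p); last first.
  rewrite big_tnth; apply: eq_bigr => i _; rewrite mxE.
  by [].
rewrite big_filter [RHS]big_mkcond big_allpairs_dep /= (bigD1_seq j) ?mem_enum ?enum_uniq //=.
rewrite [X in _ + X]big1 ?addr0; last first.
  move=> j' jj'; rewrite big1 // => w _.
  by rewrite (negPf jj') mul0r if_same.
apply: eq_bigr => w _; rewrite eqxx mul1r; case: ifP => // nb.
apply/eqP; apply: contraFT nb => hp; apply/bP; by exists p.
Qed.

End Eigenfunctions.

(** * Integer matrices *)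

Section IntegerMatrices.

Local Notation ratmx := (map_mx (intr : int -> rat)).

Lemma ratmx_inj a b : injective (fun M : 'M[int]_(a, b) => ratmx M).
Proof.
move=> M N /matrixP MN; apply/matrixP => i j; apply: (@intr_inj rat).
by have := MN i j; rewrite !mxE.
Qed.

Lemma clear_denominators a b (A : 'M[rat]_(a, b)) :
  exists2 D : nat, (0 < D)%N & exists B : 'M[int]_(a, b), ratmx B = D%:R *: A.
Proof.
pose den (u : 'I_a * 'I_b) := `|denq (A u.1 u.2)|%N.
exists (\prod_u den u)%N.
  by apply/prodn_gt0 => u; rewrite /den absz_gt0 denq_neq0.
exists (\matrix_(i, j) (numq (A i j) * (\prod_(u | u != (i, j)) den u)%N%:Z)).
apply/matrixP => i j; rewrite !mxE rmorphM /= numqE.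
rewrite -[denq (A i j)]absz_denq [in RHS](bigD1 (i, j)) //= natrM -!pmulrn /den /=.
by ring.
Qed.

(** The integral form, with a denominator, of the existence of a left inverse
    of an injective matrix over the rationals. *)
Lemma left_inverse_of_trivial_kernel a b (M : 'M[int]_(a, b)) :
  (forall v : 'cV[int]_b, M *m v = 0 -> v = 0) ->
  exists2 D : nat, (0 < D)%N & exists C : 'M[int]_(b, a), C *m M = (D%:Z)%:M.
Proof.
move=> kerM; have M_full : row_full (ratmx M).
  rewrite /row_full -mxrank_tr -/(row_free _) -kermx_eq0; apply/eqP/trmx_inj/matrixP => i j.
  rewrite trmx0; set A := (kermx _)^T.
  have MA : ratmx M *m A = 0.
    by apply: trmx_inj; rewrite trmx_mul trmxK mulmx_ker trmx0.
  have [D D0 [B BE]] := clear_denominators A.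
  have B0 : B = 0.
    apply/matrixP => i' j'.
    have /kerM/matrixP/(_ i' 0) : M *m col j' B = 0.
      have MB : M *m B = 0.
        by apply: ratmx_inj; rewrite /= map_mxM BE -scalemxAr MA scaler0 map_mx0.
      by rewrite colE mulmxA MB mul0mx.
    by rewrite !mxE.
  have /matrixP/(_ i j) := BE; rewrite B0 !mxE => /esym/eqP.
  by rewrite mulf_eq0 pnatr_eq0 eqn0Ngt D0 => /eqP.
have [D D0 [C CE]] := clear_denominators (pinvmx (ratmx M)).
exists D => //; exists C; apply: ratmx_inj => /=.
by rewrite map_mxM CE -scalemxAl mulVpmx // map_scalar_mx scalemx1.
Qed.

Lemma right_inverse_of_trivial_kernel a b (M : 'M[int]_(a, b)) :
  (forall v : 'rV[int]_a, v *m M = 0 -> v = 0) ->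
  exists2 D : nat, (0 < D)%N & exists E : 'M[int]_(b, a), M *m E = (D%:Z)%:M.
Proof.
move=> kerM; have [v Mv|D D0 [C CE]] := @left_inverse_of_trivial_kernel _ _ M^T.
  apply: trmx_inj; rewrite trmx0; apply: kerM.
  by apply: trmx_inj; rewrite trmx_mul trmxK Mv trmx0.
by exists D => //; exists C^T; apply: trmx_inj; rewrite trmx_mul trmxK CE tr_scalar_mx.
Qed.

(** Injectivity on Z^b means rank b; with a <= b this is also the number of
    rows, so that the rows are independent. *)
Lemma kernel_ranks a b (M : 'M[int]_(a, b)) :
  (a <= b)%N -> (forall v : 'cV[int]_b, M *m v = 0 -> v = 0) ->
  forall v : 'rV[int]_a, v *m M = 0 -> v = 0.
Proof.
move=> ab /left_inverse_of_trivial_kernel[D D0 [C CE]] v vM.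
have rM : row_full (ratmx M).
  apply/row_fullP; exists (D%:R^-1 *: ratmx C).
  rewrite -scalemxAl -map_mxM CE map_scalar_mx -scalemx1 scalerA mulVf ?scale1r //.
  by rewrite pnatr_eq0 -lt0n.
have fM : row_free (ratmx M).
  rewrite /row_free eqn_leq rank_leq_row /=.
  by move: rM; rewrite /row_full => /eqP ->.
apply: ratmx_inj; apply: (row_free_inj fM).
by rewrite /= map_mx0 mul0mx -map_mxM vM map_mx0.
Qed.

(** Read multiplicatively on a torus: [P] maps it to a divisible subgroup of the
    kernel of [M], and D-th powers of points of that kernel lie there; so D
    kills the component group of the kernel. *)
Lemma integral_pseudo_inverse a b (M : 'M[int]_(a, b)) :
  exists2 D : nat, (0 < D)%N & exists (P : 'M[int]_b) (N : 'M[int]_(b, a)),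
    M *m P = 0 /\ (D%:Z)%:M = P + N *m M.
Proof.
have [D D0 [N NE]] := clear_denominators (pinvmx (ratmx M)).
exists D => //; exists ((D%:Z)%:M - N *m M), N; split; last by rewrite subrK.
apply: ratmx_inj => /=; rewrite map_mxM map_mxB map_mx0 map_mxM NE.
rewrite -scalemxAl mulmxBr -scalemxAr mulmxA mulmxKpV // map_scalar_mx.
by rewrite mul_mx_scalar subrr.
Qed.

(** The rows of [B] are a basis, and the rows of [L] the coordinates, of the
    lattice spanned by the rows of the given matrix. *)
Lemma lattice_basis a b (M : 'M[int]_(a, b)) :
  exists (r : nat) (L : 'M[int]_(a, r)) (B : 'M[int]_(r, b)) (C : 'M[int]_(r, a))
         (E : 'M[int]_(b, r)) (D : nat),
    [/\ M = L *m B, C *m L = 1%:M, B *m E = (D%:Z)%:M & (0 < D)%N].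
Proof.
(* The nonzero rows of the diagonal matrix in the Smith normal form L Delta R
   are those with index in I. *)
have [L Lu [R Ru [d _ ME]]] := int_Smith_normal_form M.
set Delta := (\matrix_(i, j) _) in ME.
pose I := [set i : 'I_a | (i < b)%N && (d`_i != 0)].
pose e (i : 'I_#|I|) := enum_val i.
have DeltaI i : i \notin I -> row i Delta = 0.
  rewrite inE negb_and negbK -leqNgt => iI; apply/rowP => j; rewrite !mxE.
  case: eqP => // ij; case/orP: iI => [bi|/eqP ->]; last by rewrite mul0rn.
  by have := ltn_ord j; rewrite -ij ltnNge bi.
pose B := rowsub e (Delta *m R).
have [v vB|D D0 [E BE]] := @right_inverse_of_trivial_kernel _ _ B.
  have vD : v *m rowsub e Delta = 0.
    apply: (can_inj (mulmxK Ru)); rewrite mul0mx -vB /B.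
    by rewrite -!mulmxA -mul_rowsub_mx.
  apply/rowP => i; rewrite mxE.
  have := enum_valP i; rewrite inE => /andP[ib di].
  move/rowP/(_ (Ordinal ib)): vD; rewrite !mxE (bigD1 i) //= !mxE eqxx big1 ?addr0.
    by move=> /eqP; rewrite mulf_eq0 (negPf di) orbF => /eqP.
  move=> i' i'i; rewrite !mxE; case: eqP => [eii|]; last by rewrite mulr0n mulr0.
  by case/eqP: i'i; apply/enum_val_inj/val_inj.
exists #|I|, (colsub e L), B, (rowsub e (invmx L)), E, D; split=> //.
  rewrite ME -mulmxA; apply/matrixP => i j; rewrite !mxE.
  rewrite (bigID (mem I)) /= addrC big1 ?add0r.
    rewrite (big_enum_val (fun k => L i k * (Delta *m R) k j)) /=.
    by apply: eq_bigr => k _; rewrite !mxE.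
  move=> k /DeltaI Dk; have := congr1 (fun N => (N *m R) 0 j) Dk.
  by rewrite -row_mul mul0mx !mxE => ->; rewrite mulr0.
apply/matrixP => i j; rewrite -[e in rowsub e]/e.
have /matrixP/(_ (e i) (e j)) := mulVmx Lu; rewrite !mxE => LL.
transitivity ((e i == e j)%:R : int); last by rewrite (inj_eq enum_val_inj).
by rewrite -LL; apply: eq_bigr => k _; rewrite !mxE.
Qed.

End IntegerMatrices.

(** * Subgroups of automorphisms that are tori *)

Section Tori.
Variables (K : closedFieldType) (charK0 : [pchar K] =i pred0).

(** Evaluation at 2, which has infinite order in characteristic 0. *)
Lemma power_trivial (a : int) : (forall c : K, c != 0 -> c ^ a = 1) -> a = 0.
Proof.
have natK := natr_inj_pchar0 charK0.
have pow2 (b : nat) : (2%:R : K) ^+ b = 1 -> b = 0%N.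
  by rewrite -natrX -(mulr1n 1) => /natK; case: b => // b; rewrite expnS; lia.
have two0 : (2%:R : K) != 0 by apply/eqP => /(natK 2 0%N).
move=> /(_ _ two0); case: a => b; first by move/pow2 ->.
rewrite NegzE -exprnN => /(congr1 (@GRing.inv K)).
by rewrite invrK invr1 => /pow2.
Qed.

Lemma cocharacter_trivial d (v : 'cV[int]_d) :
  (forall c, gmpow v c = gm1 K d) -> v = 0.
Proof.
move=> v1; apply/colP => i; rewrite [RHS]mxE; apply: power_trivial => c c0.
have := congr1 (fun t => gmv t i) (v1 (mkgm (fun=> c))).
by rewrite gmv1 gmv_pow /wt big_ord1 mkgmE // mxE.
Qed.

Section Actions.
Variables (n : nat) (X : {pred 'rV[K]_n}).

Lemma automorphism_inj (phi : pt X -> pt X) : automorphism phi -> injective phi.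
Proof. by case=> psi [phiK _ _ _]; apply: can_inj phiK. Qed.

Lemma torus_iso_action d T (rho : pt (Gm K d) -> pt X -> pt X) :
  torus_iso T rho -> regular_action rho.
Proof.
case=> aut mul _ reg _; split=> // [s t p|p]; first by rewrite mul.
apply: (automorphism_inj (aut (gm1 K d))); have := mul (gm1 K d) (gm1 K d);
by rewrite Gm_mul1 => e; rewrite [in RHS]e.
Qed.

Section Action.
Variables (d : nat) (rho : pt (Gm K d) -> pt X -> pt X).
Hypothesis act : regular_action rho.

Definition gm_inv (t : pt (Gm K d)) : pt (Gm K d) := gmpow (-1%:M) t.

Lemma gm_mulV t : Gm_mul t (gm_inv t) = gm1 K d.
Proof. by rewrite -{1}[t]gmpow_id -gmpowD subrr gmpow0. Qed.

Lemma action_invl t : cancel (rho t) (rho (gm_inv t)).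
Proof.
by move=> p; rewrite -(action_mul act) Gm_mulC gm_mulV (action_one act).
Qed.

Lemma action_invr t : cancel (rho (gm_inv t)) (rho t).
Proof. by move=> p; rewrite -(action_mul act) gm_mulV (action_one act). Qed.

Lemma regmap_action p (Z : {pred 'rV[K]_p}) (phi : pt Z -> pt (Gm K d))
    (psi : pt Z -> pt X) :
  regular_map phi -> regular_map psi ->
  regular_map (fun z => rho (phi z) (psi z)).
Proof.
move=> rphi rpsi j.
apply: (reg_ext (reg_comp (regmap_pair rphi rpsi) (action_reg act j))) => z.
by rewrite pair_ptKl pair_ptKr.
Qed.

Lemma action_automorphism t : automorphism (rho t).
Proof.
exists (rho (gm_inv t)); split.
- exact: action_invl.
- exact: action_invr.
- exact: (@regmap_action _ _ (fun=> t) id (regmap_cst t) (regmap_id X)).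
- exact: (@regmap_action _ _ (fun=> gm_inv t) id (regmap_cst _) (regmap_id X)).
Qed.

Variables (q : nat) (chi : 'M[int]_(q, d)) (g : 'I_q -> pt X -> K).
Variable A : 'M[K]_(n, q).
Hypothesis eig : eigen_coordinates rho chi g A.

Lemma action_coord t (p : pt X) j :
  val (rho t p) 0 j = \sum_i A j i * (wt t (row i chi) * g i p).
Proof. by rewrite (eigen_coord eig); under eq_bigr do rewrite (eigen_wt eig). Qed.

Lemma action_ext s t :
  (forall i, wt s (row i chi) = wt t (row i chi)) -> rho s = rho t.
Proof.
move=> st; apply: functional_extensionality => p; apply: pt_ext => j.
by rewrite !action_coord; under eq_bigr do rewrite st.
Qed.

Lemma action_ext_wt s t i : rho s = rho t -> wt s (row i chi) = wt t (row i chi).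
Proof.
move=> st; have [p gp] := eigen_neq0 eig i; apply: (mulIf gp).
by rewrite -!(eigen_wt eig) st.
Qed.

Lemma action_fixed t p :
  rho t p = p <-> forall i, g i p != 0 -> wt t (row i chi) = 1.
Proof.
split=> [tp i gp|t1].
  by apply: (mulIf gp); rewrite -(eigen_wt eig) tp mul1r.
apply: pt_ext => j; rewrite action_coord (eigen_coord eig).
apply: eq_bigr => i _; congr (_ * _).
by have [->|/t1 ->] := eqVneq (g i p) 0; rewrite ?mulr0 ?mul1r.
Qed.

(** A cocharacter on which all weights vanish acts trivially. *)
Lemma faithful_weights :
  injective rho -> forall v : 'cV[int]_d, chi *m v = 0 -> v = 0.
Proof.
move=> rho_inj v chiv; apply: cocharacter_trivial => c.
apply/rho_inj/action_ext => i.
by rewrite wt_pow -row_mul chiv row0 wt0 wt1.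
Qed.

(** The image of an action of a torus is the torus whose character group is
    the lattice of weights; a basis of that lattice provides its coordinates. *)
Lemma image_torus : torus (fun phi => exists t, phi = rho t).
Proof.
have [r [L [B [C [E [D [chiE CL BE D0]]]]]]] := lattice_basis chi.
have Bsurj (s : pt (Gm K r)) : exists t : pt (Gm K d), gmpow B t = s.
  by have [s' <-] := gm_root s D0; exists (gmpow E s'); rewrite gmpowM BE.
have [lift liftK] := choice _ Bsurj.
have wtL t i : wt t (row i chi) = wt (gmpow B t) (row i L).
  by rewrite wt_pow -row_mul -chiE.
have lift_pow t : rho (lift (gmpow B t)) = rho t.
  by apply: action_ext => i; rewrite !wtL liftK.
exists r, (fun s => rho (lift s)); split=> [s|s t|s t st|j|phi].
- exact: action_automorphism.
- apply: functional_extensionality => p /=; rewrite -(action_mul act).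
  congr (_ p); apply: action_ext => i.
  by rewrite wtM !wtL !liftK wtM.
- have invL u : gmpow C (gmpow L u) = u by rewrite gmpowM CL gmpow_id.
  rewrite -[s]invL -[t]invL; congr (gmpow C _); apply: gm_ext => i.
  by rewrite !gmv_pow -[in LHS](liftK s) -[in RHS](liftK t) -!wtL; apply: action_ext_wt.
- apply: (@reg_ext _ _ _ (fun u : pt (prod_var (Gm K r) X) =>
    \sum_i A j i * (wt (proj_l u) (row i L) * g i (proj_r u)))).
    apply: reg_sum => i _; apply: regM; first exact: reg_cst.
    apply: regM; first exact: (reg_comp (regmap_l (Gm K r) X) (reg_wt (row i L))).
    exact: (reg_comp (regmap_r (Gm K r) X) (eigen_reg eig i)).
  move=> u; rewrite action_coord; apply: eq_bigr => i _.
  by rewrite wtL liftK.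
split=> [[t ->]|[s ->]]; last by exists (lift s).
by exists (gmpow B t); rewrite lift_pow.
Qed.

End Action.

(** For a torus: e kills the component groups of the point stabilizers. Indeed
    the identity component of a stabilizer, a torus, consists of the elements
    that have roots of all orders in the stabilizer. *)
Definition stabilizer_exponent (T : (pt X -> pt X) -> Prop) (e : nat) : Prop :=
  forall p phi r, T phi -> phi p = p -> (0 < r)%N ->
    exists psi, [/\ T psi, psi p = p & forall x, iter r psi x = iter e phi x].

Lemma action_iter d (rho : pt (Gm K d) -> pt X -> pt X) t e p :
  regular_action rho -> iter e (rho t) p = rho (gmpow (e%:Z)%:M t) p.
Proof.
move=> act; elim: e => [|e IHe]; first by rewrite raddf0 gmpow0 (action_one act).
rewrite iterS IHe -(action_mul act); congr (rho _ p).
by rewrite -{1}[t]gmpow_id -gmpowD -raddfD /= -intS.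
Qed.

(** The stabilizer of p is cut out by the weights of the eigenfunctions that do
    not vanish at p, and finitely many sets of weights occur. *)
Lemma stabilizer_exponent_exists T :
  torus T -> exists2 e, (0 < e)%N & stabilizer_exponent T e.
Proof.
case=> d [rho iso]; have act := torus_iso_action iso.
have [q [chi [g [A eig]]]] := eigen_coordinates_exist charK0 act.
have [_ _ _ _ TE] := iso.
pose chiI (I : {set 'I_q}) := \matrix_i (if i \in I then row i chi else 0).
have pinv (I : {set 'I_q}) : exists D : nat, (0 < D)%N /\
    exists (P : 'M[int]_d) (N : 'M[int]_(d, q)),
    chiI I *m P = 0 /\ (D%:Z)%:M = P + N *m chiI I.
  by have [D D0 PN] := integral_pseudo_inverse (chiI I); exists D.
have [D DP] := choice _ pinv.
exists (\prod_I D I)%N; first by apply/prodn_gt0 => I; have [] := DP I.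
move=> p phi r /TE[t ->] tp r0.
pose I := [set i | g i p != 0].
have [_ [P [N [chiP DE]]]] := DP I.
have [s sE] := gm_root t r0.
have chi1 i : i \in I -> row i chi = row i (chiI I) by move=> iI; rewrite rowK iI.
have ts : gmpow (D I)%:Z%:M t = gmpow P t.
  rewrite DE gmpowD -gmpowM [gmpow (chiI I) t](_ : _ = gm1 K q).
    by rewrite gmpow1 Gm_mulC Gm_mul1.
  apply: gm_ext => i; rewrite gmv1 gmv_pow rowK; case: ifP => [|_]; last exact: wt0.
  by rewrite inE; apply: (action_fixed eig t p).1.
pose F : nat := (\prod_(J | J != I) D J)%N.
exists (rho (gmpow (F%:Z)%:M (gmpow P s))); split=> [||x].
- by apply/TE; eexists.
- apply/(action_fixed eig) => i; rewrite -/(_ != 0) => gi.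
  rewrite gmpowM wt_pow chi1 ?inE // mulmxA -row_mul.
  by rewrite mul_mx_scalar -row_mul -scalemxAl chiP scaler0 row0 wt0.
rewrite !(action_iter _ _ _ act) (bigD1 I) //= -/F; congr (rho _ x).
rewrite mulnC PoszM scalar_mxM -[RHS]gmpowM ts -sE !gmpowM.
by rewrite -!mulmxA scalar_mxC !mulmxA scalar_mxC.
Qed.

End Actions.
End Tori.

(** * The dimension of a torus of automorphisms *)

Section Dimension.
Variables (K : closedFieldType) (charK0 : [pchar K] =i pred0).
Variables (n : nat) (X : {pred 'rV[K]_n}).

(** An injective homomorphism to a torus of no larger dimension is surjective;
    the point is that the inclusion of [T1] into [T2], given as an
    abstract homomorphism, is up to isogeny given by an integer matrix. *)
Lemma subtorus_eq T1 T2 d1 d2 (rho1 : pt (Gm K d1) -> pt X -> pt X)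
    (rho2 : pt (Gm K d2) -> pt X -> pt X) :
  torus_iso T1 rho1 -> torus_iso T2 rho2 -> (d2 <= d1)%N ->
  torus_sub T1 T2 -> torus_sub T2 T1.
Proof.
move=> iso1 iso2 d21 T12.
have [act1 act2] := (torus_iso_action iso1, torus_iso_action iso2).
have [q [chi [g [A eig]]]] := eigen_coordinates_exist charK0 act2.
have [_ _ inj1 _ T1E] := iso1; have [_ _ inj2 _ T2E] := iso2.
have incl t : exists s, rho1 t = rho2 s by apply/T2E/T12/T1E; exists t.
have {incl}[sigma sigmaE] := choice _ incl.
(* The pullback of a weight by sigma is a quotient of values of an
   eigenfunction, so a nowhere vanishing regular function, hence a character. *)
have wt_sigma i : exists w, forall t, wt (sigma t) (row i chi) = wt t w.
  have [p gp] := eigen_neq0 eig i.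
  have gE t : g i (rho1 t p) = wt (sigma t) (row i chi) * g i p.
    by rewrite sigmaE (eigen_wt eig).
  have [ws [h [ws_uniq _ hE]]] :=
    laurent_expansion (reg_comp (action_reg act1) (eigen_reg eig i)).
  have gh t : g i (rho1 t p) = \sum_(w <- ws) h w p * wt t w.
    by rewrite -hE pair_ptKl pair_ptKr.
  have [t|w0 ws0 h0] := nonvanishing_laurent ws_uniq (a := h^~ p).
    by rewrite -gh gE mulf_neq0 ?wt_neq0.
  have {}gh t : g i (rho1 t p) = h w0 p * wt t w0.
    rewrite gh (bigD1_seq w0) //= big_seq_cond big1 ?addr0 // => w /andP[ws_w ww0].
    by rewrite h0 ?mul0r.
  exists w0 => t; apply: (mulIf gp); rewrite -gE gh mulrC; congr (_ * _).
  by rewrite -[p in RHS](action_one act1) gh wt1 mulr1.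
have [w wE] := choice _ wt_sigma.
have [D D0 [C CE]] :=
  left_inverse_of_trivial_kernel (faithful_weights charK0 eig inj2).
pose S : 'M[int]_(d2, d1) := C *m \matrix_i w i.
have sigmaD t : gmpow (D%:Z)%:M (sigma t) = gmpow S t.
  rewrite -CE -!gmpowM; congr (gmpow C _); apply: gm_ext => i.
  by rewrite !gmv_pow wE rowK.
have rho1D t : rho1 (gmpow (D%:Z)%:M t) = rho2 (gmpow S t).
  rewrite -sigmaD; apply: functional_extensionality => p.
  by rewrite -!action_iter // sigmaE.
have kerS (v : 'cV[int]_d1) : S *m v = 0 -> v = 0.
  move=> Sv; suff Dv : D%:Z *: v = 0.
    apply/colP => j; move/colP/(_ j): Dv; rewrite !mxE => /eqP.
    by rewrite mulf_eq0 => /orP[|/eqP //]; move: D0; lia.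
  apply: (cocharacter_trivial charK0) => c; apply: inj1.
  rewrite -mul_scalar_mx -gmpowM rho1D gmpowM Sv gmpow0.
  apply: functional_extensionality => p.
  by rewrite (action_one act1) (action_one act2).
have [D' D'0 [E SE]] := right_inverse_of_trivial_kernel (kernel_ranks d21 kerS).
move=> _ /T2E[s ->]; have [s' <-] := gm_root s D'0.
by apply/T1E; exists (gmpow (D%:Z)%:M (gmpow E s')); rewrite rho1D gmpowM SE.
Qed.

(** For a closed X this means that X is irreducible or empty. *)
Definition domain : Prop := forall f g : pt X -> K,
  regular_fun f -> regular_fun g ->
  (exists p, f p != 0) -> (exists p, g p != 0) -> exists p, f p * g p != 0.

Lemma domain_prod (I : Type) (s : seq I) (f : I -> pt X -> K) :
  domain -> (exists p : pt X, true) ->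
  (forall i, regular_fun (f i)) -> (forall i, exists p, f i p != 0) ->
  exists p, \prod_(i <- s) f i p != 0.
Proof.
move=> domX [p0 _] f_reg f_neq0; elim: s => [|i s IHs].
  by exists p0; rewrite big_nil oner_neq0.
have [|p fp] := domX _ _ (f_reg i) _ (f_neq0 i) IHs.
  by apply: reg_prod => j _; apply: f_reg.
by exists p; rewrite big_cons.
Qed.

End Dimension.

Section AlgebraicDependence.
Variable K : fieldType.

Let deg_le N (p : {mpoly K[N]}) (s : nat) := forall m, m \in msupp p -> (mdeg m <= s)%N.

Let deg_leM N (p q : {mpoly K[N]}) s t :
  deg_le p s -> deg_le q t -> deg_le (p * q) (s + t).
Proof.
move=> ps qt m /msuppM_le/allpairsP[[m1 m2] /= [m1p m2q ->]].
by rewrite mdegD leq_add ?ps ?qt.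
Qed.

Let deg_leX N (p : {mpoly K[N]}) s i : deg_le p s -> deg_le (p ^+ i) (s * i).
Proof.
move=> ps; elim: i => [|i IHi]; last by rewrite exprS mulnS; apply: deg_leM.
by move=> m; rewrite expr0 msupp1 inE => /eqP ->; rewrite mdeg0.
Qed.

Let deg_le_prod N (I : Type) (r : seq I) (p : I -> {mpoly K[N]}) (s : I -> nat) :
  (forall i, deg_le (p i) (s i)) -> deg_le (\prod_(i <- r) p i) (\sum_(i <- r) s i).
Proof.
move=> ps; elim: r => [|i r IHr]; last by rewrite !big_cons; apply: deg_leM.
by move=> m; rewrite big_nil msupp1 inE => /eqP ->; rewrite mdeg0.
Qed.

(** More polynomials than variables are algebraically dependent: the number of
    monomials with exponents less than D in the d polynomials is D^d, whereas
    their degrees, bounded by a multiple of D, leave only O(D^N) coefficients. *)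
Lemma algebraic_dependence N d (p : 'I_d -> {mpoly K[N]}) : (N < d)%N ->
  exists (D : nat) (c : {ffun 'I_d -> 'I_D} -> K),
    (exists a, c a != 0) /\ \sum_a c a *: \prod_i p i ^+ a i = 0.
Proof.
move=> Nd; pose e := (\sum_i msize (p i))%N.
pose b := (d * e + 1)%N; pose D := (b ^ N + 1)%N; pose s := (d * e * D).+1.
have card_lt : (s ^ N < D ^ d)%N.
  have D0 : (0 < D)%N by rewrite /D addn1.
  have sb : (s <= b * D)%N by rewrite /s /b mulnDl mul1n -addn1 leq_add2l.
  have sN : (s ^ N <= (b * D) ^ N)%N.
    by case: (N) => // N'; rewrite leq_exp2r.
  apply: leq_ltn_trans sN _; rewrite expnMn.
  apply: (@leq_trans (D ^ N.+1)); last by rewrite leq_pexp2l.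
  by rewrite expnS ltn_pmul2r ?expn_gt0 ?D0 // /D addn1.
have p_deg i : deg_le (p i) e.
  move=> m /msize_mdeg_lt/ltnW/leq_trans; apply.
  by rewrite /e (bigD1 i) //= leq_addr.
pose pow (a : {ffun 'I_d -> 'I_D}) := \prod_i p i ^+ a i.
have pow_deg a : deg_le (pow a) s.-1.
  move=> m /(deg_le_prod (fun i => deg_leX (i := a i) (p_deg i)))/leq_trans; apply.
  apply: (@leq_trans (\sum_(i < d) e * D)).
    by apply: leq_sum => i _; rewrite leq_mul2l (ltnW (ltn_ord _)) orbT.
  by rewrite sum_nat_const card_ord mulnA.
pose box (u : {ffun 'I_N -> 'I_s}) : 'X_{1..N} := [multinom (u i : nat) | i < N].
have boxP m : (mdeg m < s)%N -> exists u, box u = m.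
  move=> ms; have mi i : (m i < s)%N.
    by apply: leq_ltn_trans ms; rewrite mdegE (bigD1 i) //= leq_addr.
  by exists [ffun i => Ordinal (mi i)]; apply/mnmP => i; rewrite mnmE ffunE.
pose M := \matrix_(i < #|{ffun 'I_d -> 'I_D}|, j < #|{ffun 'I_N -> 'I_s}|)
            (pow (enum_val i))@_(box (enum_val j)).
have : kermx M != 0.
  rewrite kermx_eq0 /row_free; apply: contraTneq card_lt => rM.
  rewrite -leqNgt; have := rank_leq_col M; rewrite rM.
  by rewrite !card_ffun !card_ord.
case/rowV0Pn => v /sub_kermxP vM v0.
exists D, (fun a => v 0 (enum_rank a)); split.
  case/rV0Pn: v0 => i vi; exists (enum_val i).
  by rewrite enum_valK.
apply/mpolyP => m; rewrite mcoeff0 raddf_sum /=.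
have [ms|ms] := ltnP (mdeg m) s; last first.
  rewrite big1 // => a _; rewrite mcoeffZ memN_msupp_eq0 ?mulr0 //.
  by apply: contraTN ms => /pow_deg; rewrite -ltnNge.
have [u <-] := boxP m ms.
have := congr1 (fun A : 'rV_ _ => A 0 (enum_rank u)) vM; rewrite !mxE => vMu; rewrite -[RHS]vMu.
rewrite (reindex (@enum_val _ xpredT)) /=; last first.
  by exists enum_rank => i _; rewrite ?enum_valK ?enum_rankK.
by apply: eq_bigr => i _; rewrite mcoeffZ !mxE enum_valK enum_rankK.
Qed.

End AlgebraicDependence.

(** Eigenfunctions with independent weights are algebraically independent, as
    long as their products do not vanish identically. *)
Lemma torus_dim_le (K : closedFieldType) (charK0 : [pchar K] =i pred0) n
    (X : {pred 'rV[K]_n}) d T (rho : pt (Gm K d) -> pt X -> pt X) :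
  domain X -> (exists p : pt X, true) -> torus_iso T rho -> (d <= n)%N.
Proof.
move=> domX neX iso; rewrite leqNgt; apply/negP => nd.
have act := torus_iso_action iso; have [_ _ inj _ _] := iso.
have [q [chi [g [A eig]]]] := eigen_coordinates_exist charK0 act.
have [D D0 [C CE]] :=
  left_inverse_of_trivial_kernel (faithful_weights charK0 eig inj).
have rfull : row_full (map_mx (intr : int -> rat) chi).
  apply/row_fullP; exists (D%:R^-1 *: map_mx intr C).
  rewrite -scalemxAl -map_mxM CE map_scalar_mx -scalemx1 scalerA mulVf ?scale1r //.
  by rewrite pnatr_eq0 -lt0n.
pose f := fullrankfun rfull.
have w_inj : injective (fun v : 'rV[int]_d => v *m rowsub f chi).
  move=> v1 v2 /(congr1 (map_mx (intr : int -> rat))).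
  rewrite !map_mxM map_mxsub => v12; apply: ratmx_inj; move: v12.
  exact: (row_free_inj (fullrowsub_free rfull)).
have [P PE] := choice _ (fun i => eigen_reg eig (f i)).
have [D1 [c [[a0 ca0] c0]]] := algebraic_dependence P nd.
pose G (a : {ffun 'I_d -> 'I_D1}) p := \prod_i g (f i) p ^+ a i.
pose W (a : {ffun 'I_d -> 'I_D1}) := (\row_i (a i)%:Z) *m rowsub f chi.
have W_inj : injective W.
  move=> a b /w_inj/rowP ab; apply/ffunP => i; apply/val_inj/eqP.
  by have := ab i; rewrite !mxE => -[ai]; apply/eqP.
have [p gp] := domain_prod (index_enum 'I_d) domX neX
  (fun i => eigen_reg eig (f i)) (fun i => eigen_neq0 eig (f i)).
have G0 a : G a p != 0.
  apply/prodf_neq0 => i _; apply: expf_neq0.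
  by move/prodf_neq0: gp => /(_ i isT).
pose alpha w := \sum_(a | W a == w) c a * G a p.
have alphaW a : alpha (W a) = c a * G a p.
  by rewrite /alpha (eq_bigl (pred1 a)) ?big_pred1_eq // => b; apply: (inj_eq W_inj).
have alpha0 t : \sum_(w <- [seq W a | a <- index_enum _]) alpha w * wt t w = 0.
  rewrite big_map; have := congr1 (fun Q => Q.@[val (rho t p) 0]) c0.
  rewrite raddf_sum meval0 /= => {2}<-; apply: eq_bigr => a _.
  rewrite alphaW mevalZ rmorph_prod -mulrA; congr (_ * _).
  rewrite /W mulmx_sum_row wt_sum -big_split; apply: eq_bigr => i _ /=.
  rewrite rmorphXn /= -PE (eigen_wt eig) exprMn mulrC mxE wtZ row_rowsub.
  by rewrite -exprnP.
have W_uniq : uniq [seq W a | a <- index_enum _].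
  by rewrite map_inj_uniq // index_enum_uniq.
have /eqP := characters_indep charK0 W_uniq alpha0 (map_f W (mem_index_enum a0)).
by rewrite alphaW mulf_eq0 (negPf ca0) (negPf (G0 a0)).
Qed.

(** * Points of a suspension times the line *)

Section Suspension.
Variables (K : closedFieldType) (n : nat) (V : {pred 'rV[K]_n}) (f : pt V -> K).

Section General.
Variables (m : nat) (k : m.-tuple nat).

Lemma susp_base_subproof (u : pt (susp f k)) : rsubmx (val u) \in V.
Proof. by have := valP u; rewrite inE /=; case: insubP. Qed.

Definition susp_base (u : pt (susp f k)) : pt V :=
  exist _ (rsubmx (val u)) (susp_base_subproof u).

Lemma susp_eqn (u : pt (susp f k)) :
  \prod_(i < m) val u 0 (lshift n i) ^+ tnth k i = f (susp_base u).
Proof.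
have := valP u; rewrite inE /=; case: insubP => //= v Vu vE /eqP.
rewrite (_ : v = susp_base u) => [<-|]; last exact: val_inj.
by apply: eq_bigr => i _; rewrite mxE.
Qed.

Lemma mk_susp_subproof (y : 'I_m -> K) (v : pt V) :
  \prod_(i < m) y i ^+ tnth k i = f v ->
  row_mx (\row_i y i) (val v) \in susp f k.
Proof.
move=> yv; rewrite inE /= row_mxKr row_mxKl valK /= -yv; apply/eqP.
by apply: eq_bigr => i _; rewrite mxE.
Qed.

Definition mk_susp y v (yv : \prod_(i < m) y i ^+ tnth k i = f v) :
    pt (susp f k) :=
  exist _ (row_mx (\row_i y i) (val v)) (mk_susp_subproof yv).

End General.

Variables (m : nat) (l : m.-tuple nat).

(** The product with the line of the hypersurface x y^l = f(v); its points are
    written (x, y, v, u). *)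
Definition suspline := prod_var (susp f [tuple of 1%N :: l]) (affine_line K).

Implicit Types p q : pt suspline.

Definition zx p : K := val p 0 (lshift 1 (lshift n ord0)).
Definition zy p (i : 'I_m) : K := val p 0 (lshift 1 (lshift n (lift ord0 i))).
Definition zv p : pt V := susp_base (proj_l p).
Definition zu p : K := val p 0 (rshift (m.+1 + n) ord0).

Definition ymon (y : 'I_m -> K) : K := \prod_i y i ^+ tnth l i.

Lemma ymonM y1 y2 : ymon (fun i => y1 i * y2 i) = ymon y1 * ymon y2.
Proof. by rewrite -big_split; apply: eq_bigr => i _; rewrite exprMn. Qed.

Lemma zeqn p : zx p * ymon (zy p) = f (zv p).
Proof.
rewrite -susp_eqn big_ord_recl [tnth _ ord0]/= expr1 !mxE; congr (_ * _).
by apply: eq_bigr => i _; rewrite !mxE tnthS.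
Qed.

Definition zcoord x (y : 'I_m -> K) (i : 'I_m.+1) : K := oapp y x (unlift ord0 i).

Lemma mkZ_subproof x y v : x * ymon y = f v ->
  \prod_(i < m.+1) zcoord x y i ^+ tnth [tuple of 1%N :: l] i = f v.
Proof.
move=> <-; rewrite big_ord_recl [tnth _ ord0]/= expr1 {1}/zcoord unlift_none /=.
by congr (_ * _); apply: eq_bigr => i _; rewrite tnthS /zcoord liftK.
Qed.

Definition mkZ x y v u (xyv : x * ymon y = f v) : pt suspline :=
  pair_pt (mk_susp (mkZ_subproof xyv))
          (exist _ (const_mx u) isT : pt (affine_line K)).

Lemma mkZx x y v u (xyv : x * ymon y = f v) : zx (mkZ u xyv) = x.
Proof. by rewrite /zx /= !row_mxEl mxE /zcoord unlift_none. Qed.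

Lemma mkZy x y v u (xyv : x * ymon y = f v) i : zy (mkZ u xyv) i = y i.
Proof. by rewrite /zy /= !row_mxEl mxE /zcoord liftK. Qed.

Lemma mkZv x y v u (xyv : x * ymon y = f v) : zv (mkZ u xyv) = v.
Proof. by rewrite /zv /mkZ pair_ptKl; apply: val_inj; rewrite /= row_mxKr. Qed.

Lemma mkZu x y v u (xyv : x * ymon y = f v) : zu (mkZ u xyv) = u.
Proof. by rewrite /zu /= row_mxEr mxE. Qed.

Lemma Z_index (P : 'I_(m.+1 + n + 1) -> Prop) :
  P (lshift 1 (lshift n ord0)) ->
  (forall i, P (lshift 1 (lshift n (lift ord0 i)))) ->
  (forall j, P (lshift 1 (rshift m.+1 j))) ->
  P (rshift (m.+1 + n) ord0) -> forall j, P j.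
Proof.
move=> Px Py Pv Pu j; case: (split_ordP j) => {j} [j|j] ->; last by rewrite ord1.
case: (split_ordP j) => {j} j -> //.
by case: (unliftP ord0 j) => [i|] ->.
Qed.

Lemma zvE p j : val p 0 (lshift 1 (rshift m.+1 j)) = val (zv p) 0 j.
Proof. by rewrite !mxE. Qed.

Lemma Z_ext p q :
  zx p = zx q -> (forall i, zy p i = zy q i) -> zv p = zv q -> zu p = zu q ->
  p = q.
Proof.
move=> ex ey ev eu; apply: pt_ext; apply: Z_index => // j.
by rewrite !zvE ev.
Qed.

Lemma regmap_Z a (A : {pred 'rV[K]_a}) (phi : pt A -> pt suspline) :
  regular_fun (fun t => zx (phi t)) ->
  (forall i, regular_fun (fun t => zy (phi t) i)) ->
  regular_map (fun t => zv (phi t)) -> regular_fun (fun t => zu (phi t)) ->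
  regular_map phi.
Proof.
move=> rx ry rv ru; apply: Z_index => // j.
by apply: (reg_ext (rv j)) => t; rewrite zvE.
Qed.

Lemma reg_zx : regular_fun zx. Proof. exact: reg_coord. Qed.
Lemma reg_zy i : regular_fun (fun p => zy p i). Proof. exact: reg_coord. Qed.
Lemma reg_zu : regular_fun zu. Proof. exact: reg_coord. Qed.
Lemma regmap_zv : regular_map zv.
Proof.
by move=> j; apply: (reg_ext (reg_coord _ (lshift 1 (rshift m.+1 j)))) => p; rewrite zvE.
Qed.

End Suspension.

(** * The Danielewski isomorphism *)

(** Truncations of (1 - X)^(-1/e), obtained by successive approximation. *)
Lemma root_of_unit_series (K : fieldType) (e q : nat) : (e%:R : K) != 0 ->
  exists u v : {poly K}, 1 - (1 - 'X) * (1 + 'X * u) ^+ e = 'X^(q.+1) * v.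
Proof.
move=> e0; elim: q => [|q [u [v uv]]].
  by exists 0, 1; rewrite mulr0 addr0 expr1n expr1 !mulr1 opprB addrC subrK.
pose c := v.[0] / e%:R; pose u' : {poly K} := u + c *: 'X^q.
pose U : {poly K} := 1 + 'X * u; pose U' : {poly K} := 1 + 'X * u'.
pose S := \sum_(i < e) U' ^+ (e.-1 - i) * U ^+ i.
have U'U : U' ^+ e - U ^+ e = c *: 'X^(q.+1) * S.
  by rewrite subrXX; congr (_ * _); rewrite /U' /u' /U exprS -!mul_polyC; ring.
have S0 : S.[0] = e%:R.
  rewrite horner_sum (eq_bigr (fun=> 1)) ?sumr_const ?card_ord // => i _.
  by rewrite /U' /U !(hornerE, horner_exp) ?mul0r ?addr0 ?expr1n ?mulr1.
have [w wE] : exists w, v - (1 - 'X) * c%:P * S = 'X * w.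
  have /factor_theorem[w wE] : root (v - (1 - 'X) * c%:P * S) 0.
    by rewrite rootE !hornerE S0 /c /=; apply/eqP; field.
  by exists w; rewrite wE subr0 mulrC.
exists u', w; rewrite -/U'.
have -> : U' ^+ e = U ^+ e + c *: 'X^(q.+1) * S by rewrite -U'U addrC subrK.
rewrite [in RHS]exprS -mulrA mulrCA -wE mulrBr -uv -/U -!mul_polyC; ring.
Qed.

(** In this section x, z are the coordinates on x y^l = a z^e + 1 and x', z' those
    on x' y_1 ... y_m = a z'^e + 1, with s and t on the extra lines; [Y] stands
    for y_1 ... y_m, [Y * Yd] for y^l, and [Yr] for the monomial completing it to
    Y^q. The isomorphism is determined by z' = z + Y s and z = h(z') + y^l t,
    where h(z') is a root of a Z^e + 1 up to the order q in a z'^e + 1. When Y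
    is nonzero, z, z' determine everything; on Y = 0, z = z' = h(z') and the
    remaining coordinates have to be compared directly. *)
Section Scalars.
Variable K : closedFieldType.
Variables (e q : nat) (ut vt : {poly K}).
Hypothesis e0 : (e%:R : K) != 0.
Hypothesis q_gt1 : (1 < q)%N.
Hypothesis series : 1 - (1 - 'X) * (1 + 'X * ut) ^+ e = 'X^q * vt.
Variables a Y Yd Yr : K.
Local Notation Yl := (Y * Yd).
Hypothesis YlYr : Yl * Yr = Y ^+ q.
Hypothesis YdYr : Yd * Yr = Y ^+ q.-1.

(** The difference quotient of a Z^e + 1. *)
Definition dq (z1 z2 : K) : K := a * \sum_(i < e) z1 ^+ (e.-1 - i) * z2 ^+ i.
Definition dh (z : K) : K :=
  z * (1 + (a * z ^+ e + 1) * ut.[a * z ^+ e + 1]).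

Lemma dqE z1 z2 : a * z1 ^+ e - a * z2 ^+ e = (z1 - z2) * dq z1 z2.
Proof. by rewrite -mulrBr subrXX /dq mulrCA. Qed.

Lemma dhE z : a * dh z ^+ e + 1 =
  (a * z ^+ e + 1) ^+ q * vt.[a * z ^+ e + 1].
Proof.
have := congr1 (fun p => p.[a * z ^+ e + 1]) series.
rewrite !(hornerE, horner_exp) => <-; rewrite /dh exprMn; ring.
Qed.

Definition fwdz (z s : K) := z + Y * s.
Definition fwdx (x z s : K) := Yd * x + s * dq (fwdz z s) z.
Definition rest (x z s : K) :=
  x - fwdx x z s ^+ q * Yr * vt.[a * fwdz z s ^+ e + 1].
Definition shift (x z s : K) :=
  s + fwdz z s * fwdx x z s * ut.[a * fwdz z s ^+ e + 1].
Definition corr (x z s : K) := e%:R * Yd * x + shift x z s * (a *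
  \sum_(i < e) z ^+ (e.-1 - i) * z *
    \sum_(j < i) dh (fwdz z s) ^+ (i.-1 - j) * z ^+ j).
(** This is t = (z - h) / y^l as a polynomial, h = h(z'). It satisfies
    t dq(z, h) = [rest], and z dq(z, h) = - e + Y [corr], because a z^e = - 1 on
    Y = 0; so dq(z, h) is inverted by a geometric series in Y, truncated where
    Y^q becomes divisible by y^l. *)
Definition fwdt (x z s : K) :=
  (\sum_(i < q) (Y * corr x z s / e%:R) ^+ i) * (- z * rest x z s / e%:R)
  + (corr x z s / e%:R) ^+ q * Yr * (z - dh (fwdz z s)).

Definition bwdz (z t : K) := dh z + Yl * t.
Definition bwdx (x z t : K) :=
  x ^+ q * Yr * vt.[a * z ^+ e + 1] + t * dq (bwdz z t) (dh z).
Definition bwds (x z t : K) := - z * x * ut.[a * z ^+ e + 1] - Yd * t.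

Section Forward.
Variables x z s : K.
Hypothesis xz : x * Yl = a * z ^+ e + 1.

Lemma fwd_eqn : fwdx x z s * Y = a * fwdz z s ^+ e + 1.
Proof.
have := dqE (fwdz z s) z; rewrite {2}/fwdz => dqz.
rewrite -[a * fwdz z s ^+ e](subrK (a * z ^+ e)) dqz -addrA -xz /fwdx; ring.
Qed.

Lemma shiftE : dh (fwdz z s) - z = Y * shift x z s.
Proof. by rewrite /dh -fwd_eqn /shift -fwd_eqn /fwdz; ring. Qed.

Lemma corrE : z * dq z (dh (fwdz z s)) = - e%:R + Y * corr x z s.
Proof.
set h := dh _; pose S i := \sum_(j < i) h ^+ (i.-1 - j) * z ^+ j.
have hX i : h ^+ i = z ^+ i + Y * shift x z s * S i.
  by rewrite -shiftE -/h -subrXX; ring.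
have -> : z * dq z h = a * (\sum_(i < e) z ^+ e) +
    Y * shift x z s * (a * \sum_(i < e) z ^+ (e.-1 - i) * z * S i).
  rewrite /dq mulrCA [in RHS]mulrCA -mulrDr mulr_sumr [in RHS]mulr_sumr -big_split /=.
  congr (_ * _); apply: eq_bigr => i _; rewrite hX.
  have -> : z ^+ e = z ^+ (e.-1 - i) * z * z ^+ i.
    by rewrite -exprSr -exprD; congr (_ ^+ _); have := ltn_ord i; lia.
  by ring.
rewrite sumr_const card_ord -[z ^+ e *+ e]mulr_natr mulrA.
have -> : a * z ^+ e = x * Yl - 1 by rewrite xz; ring.
by rewrite /corr -/h -/(S _); ring.
Qed.

Lemma restE : Yl * rest x z s = (z - dh (fwdz z s)) * dq z (dh (fwdz z s)).
Proof.
rewrite -dqE; have := dhE (fwdz z s); rewrite -fwd_eqn => hE.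
have -> : a * z ^+ e = x * Yl - 1 by rewrite xz; ring.
have -> : a * dh (fwdz z s) ^+ e = (fwdx x z s * Y) ^+ q * vt.[fwdx x z s * Y] - 1.
  by rewrite -hE; ring.
by rewrite exprMn -YlYr /rest -fwd_eqn; ring.
Qed.

Lemma fwdtE : Yl * fwdt x z s = z - dh (fwdz z s).
Proof.
rewrite /fwdt; set k := corr x z s; set h := dh _; set S := \sum_(i < q) _.
have SE : S * (1 - Y * k / e%:R) = 1 - (Y * k / e%:R) ^+ q.
  by rewrite -[RHS]opprB subrX1 -/S; ring.
transitivity (S * - (z * (Yl * rest x z s)) / e%:R
              + (k / e%:R) ^+ q * (Yl * Yr) * (z - h)); first by ring.
rewrite restE -/h YlYr [z * _]mulrCA corrE -/k.
transitivity ((z - h) * (S * (1 - Y * k / e%:R) + (Y * k / e%:R) ^+ q)).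
  by rewrite !exprMn; field.
by rewrite SE subrK mulr1.
Qed.

Lemma fwdt0 : Y = 0 -> fwdt x z s = - z * rest x z s / e%:R.
Proof.
move=> Y0; rewrite /fwdt -(opprB _ z) shiftE Y0 !mul0r oppr0 mulr0 addr0.
rewrite -(prednK (ltnW q_gt1)) big_ord_recl expr0 big1 ?addr0 ?mul1r // => i _.
by rewrite exprS mul0r.
Qed.

End Forward.

(** The coefficient of X in the relation [series]. *)
Lemma ut0 : e%:R * ut.[0] = 1.
Proof.
pose S := \sum_(i < e) (1 + 'X * ut) ^+ (e.-1 - i) * 1 ^+ i.
have S0 : S.[0] = e%:R.
  rewrite horner_sum (eq_bigr (fun=> 1)) ?sumr_const ?card_ord // => i _.
  by rewrite !(hornerE, horner_exp) ?mul0r ?addr0 ?expr1n ?mulr1.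
have XS : (1 + 'X * ut) ^+ e = 1 + 'X * ut * S.
  have := subrXX (1 + 'X * ut) 1 e; rewrite expr1n -/S => US.
  by rewrite -[LHS](subrK 1) US; ring.
have : 'X * (1 - (1 - 'X) * ut * S) = 'X * ('X^(q.-1) * vt).
  by rewrite mulrA -exprS (prednK (ltnW q_gt1)) -series XS; ring.
move/(mulfI (negbT (polyX_eq0 _)))/(congr1 (fun p => p.[0])).
rewrite !(hornerE, horner_exp) S0 expr0n subr0 mul1r.
have -> : q.-1 == 0%N = false by apply/negbTE; move: q_gt1; lia.
by rewrite mul0r => /eqP; rewrite subr_eq0 mulrC => /eqP.
Qed.

Lemma bwd_eqn x z t : x * Y = a * z ^+ e + 1 ->
  bwdx x z t * Yl = a * bwdz z t ^+ e + 1.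
Proof.
move=> xz; have := dqE (bwdz z t) (dh z); rewrite {2}/bwdz => dqz.
rewrite -[a * bwdz z t ^+ e](subrK (a * dh z ^+ e)) dqz -addrA dhE -xz.
by rewrite exprMn -YlYr /bwdx -xz; ring.
Qed.

Lemma bwdK x z s : x * Yl = a * z ^+ e + 1 ->
  let x' := fwdx x z s in let z' := fwdz z s in let t := fwdt x z s in
  [/\ bwdx x' z' t = x, bwdz z' t = z & bwds x' z' t = s].
Proof.
move=> xz x' z' t.
have zE : bwdz z' t = z by rewrite /bwdz fwdtE // addrC subrK.
have x'z' : x' * Y = a * z' ^+ e + 1 by apply: fwd_eqn.
have [Y0|Y0] := eqVneq Y 0; last first.
  have Yl0 : Yl != 0.
    by apply: contra_neq (expf_neq0 q Y0); rewrite -YlYr => ->; rewrite mul0r.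
  split=> //.
    by apply: (mulIf Yl0); rewrite bwd_eqn // zE.
  apply: (mulIf Y0); transitivity (- (dh z' - z') - Yl * t).
    by rewrite /bwds /dh -x'z'; ring.
  rewrite /t fwdtE // -/z'; set h := dh z'.
  by rewrite /z' /fwdz; ring.
have z'E : z' = z by rewrite /z' /fwdz Y0 mul0r addr0.
have f0 : a * z ^+ e + 1 = 0 by rewrite -z'E -x'z' Y0 mulr0.
have hE : dh z = z by rewrite /dh f0; ring.
have zdq : z * dq z z = - e%:R.
  by have := corrE s xz; rewrite -/z' z'E hE Y0 mul0r addr0.
have tE : t = - z * rest x z s / e%:R by apply: fwdt0.
have tdq : t * dq z z = rest x z s.
  transitivity (- (z * dq z z) * rest x z s / e%:R); first by rewrite tE; ring.
  by rewrite zdq opprK; field.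
have rE : rest x z s = x - x' ^+ q * Yr * vt.[0].
  by rewrite /rest -/x' -/z' z'E f0.
split=> //.
  by rewrite /bwdx zE z'E hE tdq f0 rE addrC subrK.
have Yd_rest : Yd * rest x z s = Yd * x.
  transitivity (Yd * x - x' ^+ q * (Yd * Yr) * vt.[0]); first by rewrite rE; ring.
  rewrite YdYr Y0 expr0n (_ : q.-1 == 0%N = false) ?mulr0 ?mul0r ?subr0 //.
  by apply/negbTE; move: q_gt1; lia.
have utE : ut.[0] = e%:R^-1 by apply: (mulfI e0); rewrite ut0 divff.
have x'E : x' = Yd * x + s * dq z z by rewrite /x' /fwdx -/z' z'E.
rewrite /bwds z'E f0 utE tE.
transitivity ((- z * x' + z * (Yd * rest x z s)) / e%:R); first by ring.
rewrite Yd_rest x'E.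
transitivity (- (z * dq z z) * s / e%:R); first by ring.
by rewrite zdq opprK; field.
Qed.

Lemma fwdK x z t : x * Y = a * z ^+ e + 1 ->
  let x' := bwdx x z t in let z' := bwdz z t in let s := bwds x z t in
  [/\ fwdx x' z' s = x, fwdz z' s = z & fwdt x' z' s = t].
Proof.
move=> xz x' z' s.
have x'z' : x' * Yl = a * z' ^+ e + 1 by apply: bwd_eqn.
have zE : fwdz z' s = z.
  transitivity (dh z - z * (x * Y) * ut.[a * z ^+ e + 1]).
    by rewrite /fwdz /z' /bwdz /s /bwds; ring.
  by rewrite /dh -xz; ring.
have [Y0|Y0] := eqVneq Y 0; last first.
  have Yl0 : Yl != 0.
    by apply: contra_neq (expf_neq0 q Y0); rewrite -YlYr => ->; rewrite mul0r.
  split=> //.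
    by apply: (mulIf Y0); rewrite fwd_eqn // zE.
  by apply: (mulfI Yl0); rewrite fwdtE // zE /z' /bwdz addrC addKr.
have f0 : a * z ^+ e + 1 = 0 by rewrite -xz Y0 mulr0.
have hE : dh z = z by rewrite /dh f0; ring.
have z'E : z' = z by rewrite /z' /bwdz hE Y0 !mul0r addr0.
have zdq : z * dq z z = - e%:R.
  by have := corrE s x'z'; rewrite zE hE z'E Y0 mul0r addr0.
have utE : ut.[0] = e%:R^-1 by apply: (mulfI e0); rewrite ut0 divff.
have x'E : x' = x ^+ q * Yr * vt.[0] + t * dq z z.
  by rewrite /x' /bwdx -/z' z'E hE f0.
have sE : s = - z * x / e%:R - Yd * t by rewrite /s /bwds f0 utE.
have YdYr0 : Yd * Yr = 0.
  rewrite YdYr Y0 expr0n (_ : q.-1 == 0%N = false) //.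
  by apply/negbTE; move: q_gt1; lia.
have xE : fwdx x' z' s = x.
  rewrite /fwdx zE z'E x'E sE.
  transitivity (x ^+ q * (Yd * Yr) * vt.[0] - (z * dq z z) * x / e%:R); first by ring.
  by rewrite YdYr0 zdq; field.
split=> //.
have rE : rest x' z' s = t * dq z z.
  by rewrite /rest xE zE f0 x'E; ring.
rewrite fwdt0 // rE z'E.
transitivity (- (z * dq z z) * t / e%:R); first by ring.
by rewrite zdq opprK; field.
Qed.

End Scalars.

(** Closure of the regular functions under the ring operations. *)
Ltac regular := first
  [ exact: reg_cst | assumption
  | lazymatch goal with
    | |- regular_fun (fun p => @?a p + @?b p) => apply: regD; regular
    | |- regular_fun (fun p => - @?a p) => apply: regN; regular
    | |- regular_fun (fun p => @?a p * @?b p) => apply: regM; regular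
    | |- regular_fun (fun p => @?a p ^+ ?i) => apply: regX; regular
    | |- regular_fun (fun p => horner ?u (@?a p)) => apply: reg_horner; regular
    | |- regular_fun _ => apply: reg_sum => ? _; regular
    end ].

Definition isomorphic (K : closedFieldType) (n1 n2 : nat) (X1 : {pred 'rV[K]_n1})
    (X2 : {pred 'rV[K]_n2}) : Prop :=
  exists (phi : pt X1 -> pt X2) (psi : pt X2 -> pt X1),
    [/\ cancel phi psi, cancel psi phi, regular_map phi & regular_map psi].

Lemma isomorphic_sym (K : closedFieldType) n1 n2 (X1 : {pred 'rV[K]_n1})
    (X2 : {pred 'rV[K]_n2}) : isomorphic X1 X2 -> isomorphic X2 X1.
Proof. by case=> phi [psi [? ? ? ?]]; exists psi, phi. Qed.

Lemma isomorphic_trans (K : closedFieldType) n1 n2 n3 (X1 : {pred 'rV[K]_n1})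
    (X2 : {pred 'rV[K]_n2}) (X3 : {pred 'rV[K]_n3}) :
  isomorphic X1 X2 -> isomorphic X2 X3 -> isomorphic X1 X3.
Proof.
case=> phi [psi [phiK psiK rphi rpsi]] [phi' [psi' [phiK' psiK' rphi' rpsi']]].
exists (fun x => phi' (phi x)), (fun x => psi (psi' x)); split.
- by move=> x; rewrite phiK' phiK.
- by move=> x; rewrite psiK psiK'.
- exact: regmap_comp rphi rphi'.
- exact: regmap_comp rpsi' rpsi.
Qed.

Section Danielewski.
Variables (K : closedFieldType) (charK0 : [pchar K] =i pred0).
Variables (n : nat) (W : {pred 'rV[K]_n}) (alpha : pt W -> K).
Hypothesis alpha_reg : regular_fun alpha.
Variable e : nat.
Hypothesis e_gt0 : (0 < e)%N.
Variables (m : nat) (l : m.-tuple nat).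
Hypothesis l_gt0 : forall i, (0 < tnth l i)%N.

Local Notation V := (prod_var W (affine_line K)).
Local Notation f := (alpha_zk_1 alpha e).
Local Notation l1 := [tuple of nseq m 1%N].

Definition mkV (w : pt W) (c : K) : pt V :=
  pair_pt w (exist _ (const_mx c) isT : pt (affine_line K)).

Lemma mkV_l w c : proj_l (mkV w c) = w.
Proof. exact: pair_ptKl. Qed.

Lemma mkV_r w c : val (proj_r (mkV w c)) 0 0 = c.
Proof. by rewrite pair_ptKr /= mxE. Qed.

Lemma mkVE (v : pt V) : mkV (proj_l v) (val (proj_r v) 0 0) = v.
Proof.
apply: prod_ext; first exact: mkV_l.
by apply: pt_ext => j; rewrite pair_ptKr /= mxE ord1.
Qed.

Lemma regmap_mkV a (A : {pred 'rV[K]_a}) (phi : pt A -> pt W) (c : pt A -> K) :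
  regular_map phi -> regular_fun c -> regular_map (fun x => mkV (phi x) (c x)).
Proof.
move=> rphi rc; apply: regmap_pair => // j.
by apply: (reg_ext rc) => x; rewrite /= mxE.
Qed.

Definition zz k (p : pt (suspline f k)) : K := val (proj_r (@zv _ _ _ _ m k p)) 0 0.
Definition za k (p : pt (suspline f k)) : K := alpha (proj_l (@zv _ _ _ _ m k p)).

Lemma zaE k (p : pt (suspline f k)) :
  zx p * ymon k (zy p) = za p * zz p ^+ e + 1.
Proof. exact: zeqn. Qed.

Lemma reg_zz k : regular_fun (@zz k).
Proof. exact: (reg_comp (regmap_comp (@regmap_zv _ _ _ f _ k) (regmap_r W _)) (reg_coord _ 0)). Qed.

Lemma reg_za k : regular_fun (@za k).
Proof. exact: (reg_comp (regmap_comp (@regmap_zv _ _ _ f _ k) (regmap_l W _)) alpha_reg). Qed.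

Lemma fE w c : f (mkV w c) = alpha w * c ^+ e + 1.
Proof. by rewrite /alpha_zk_1 mkV_l mkV_r. Qed.

Let q := (\sum_i tnth l i).+2.
Let Y (y : 'I_m -> K) := \prod_i y i.
Let Yd (y : 'I_m -> K) := \prod_i y i ^+ (tnth l i).-1.
Let Yr (y : 'I_m -> K) := \prod_i y i ^+ (q - tnth l i).

Let l_lt i : (tnth l i < q)%N.
Proof. by rewrite /q (bigD1 i) //= ltnS leqW // leq_addr. Qed.

Let YYd y : Y y * Yd y = ymon l y.
Proof.
rewrite /Y /Yd -big_split; apply: eq_bigr => i _ /=.
by rewrite -exprS prednK.
Qed.

Let YlYr y : Y y * Yd y * Yr y = Y y ^+ q.
Proof.
rewrite YYd -prodrXl -big_split; apply: eq_bigr => i _ /=.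
by rewrite -exprD; congr (_ ^+ _); have := l_lt i; lia.
Qed.

Let YdYr y : Yd y * Yr y = Y y ^+ q.-1.
Proof.
rewrite -prodrXl -big_split; apply: eq_bigr => i _ /=.
have qE : ((tnth l i).-1 + (q - tnth l i) = q.-1)%N.
  by move: (l_lt i) (l_gt0 i); move: (tnth l i) q => a b; lia.
by rewrite -exprD; congr (_ ^+ _); apply: qE.
Qed.

Let ymon1 y : ymon l1 y = Y y.
Proof. by apply: eq_bigr => i _; rewrite tnth_nseq expr1. Qed.

(** Both hypersurfaces carry a free action of the additive group moving z, and
    the quotients are the same algebraic space: the space of all (w, y), where a
    root z of f(w, z) is chosen as well when some y_i vanishes. The fibre
    product over this quotient is an affine-line bundle over either
    hypersurface, and both bundles are trivial; [fwdz], ... and [bwdz], ... are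
    the resulting changes of coordinates. *)
Lemma danielewski : isomorphic (suspline f l) (suspline f l1).
Proof.
have e0 : (e%:R : K) != 0.
  by apply: contraTneq e_gt0 => /(natr_inj_pchar0 charK0 (x2 := 0%N)) ->.
have [ut [vt series]] := root_of_unit_series q.-1 e0.
have q1 : (1 < q)%N by [].
pose F1 (p : pt (suspline f l)) := 
  fwdx e (za p) (Y (zy p)) (Yd (zy p)) (zx p) (zz p) (zu p).
pose F2 (p : pt (suspline f l)) := fwdz (Y (zy p)) (zz p) (zu p).
pose F3 (p : pt (suspline f l)) := fwdt e q ut vt (za p) (Y (zy p)) (Yd (zy p))
  (Yr (zy p)) (zx p) (zz p) (zu p).
pose B1 (p : pt (suspline f l1)) := bwdx e q ut vt (za p) (Y (zy p)) (Yd (zy p))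
  (Yr (zy p)) (zx p) (zz p) (zu p).
pose B2 (p : pt (suspline f l1)) :=
  bwdz e ut (za p) (Y (zy p)) (Yd (zy p)) (zz p) (zu p).
pose B3 (p : pt (suspline f l1)) := bwds e ut (za p) (Yd (zy p)) (zx p) (zz p) (zu p).
have eqF (p : pt (suspline f l)) :
    F1 p * ymon l1 (zy p) = f (mkV (proj_l (zv p)) (F2 p)).
  by rewrite fE ymon1; apply: fwd_eqn; rewrite YYd zaE.
have eqB (p : pt (suspline f l1)) :
    B1 p * ymon l (zy p) = f (mkV (proj_l (zv p)) (B2 p)).
  rewrite fE -YYd; apply: (bwd_eqn series (YlYr (zy p))).
  by rewrite -ymon1 zaE.
pose phi p : pt (suspline f l1) := mkZ (F3 p) (eqF p).
pose psi p : pt (suspline f l) := mkZ (B3 p) (eqB p).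
exists phi, psi; split.
- move=> p.
  have zyE : zy (phi p) = zy p by apply: functional_extensionality => i; rewrite mkZy.
  have zaE' : za (phi p) = za p by rewrite /za mkZv mkV_l.
  have zzE : zz (phi p) = F2 p by rewrite /zz mkZv mkV_r.
  have xz : zx p * (Y (zy p) * Yd (zy p)) = za p * zz p ^+ e + 1 by rewrite YYd zaE.
  have [E1 E2 E3] := bwdK e0 q1 series (YlYr (zy p)) (YdYr (zy p)) (zu p) xz.
  apply: Z_ext.
  + by rewrite mkZx /B1 zyE zaE' zzE mkZx mkZu.
  + by move=> i; rewrite mkZy zyE.
  + by rewrite mkZv /B2 zyE zaE' zzE mkZu mkZv mkV_l E2 mkVE.
  + by rewrite mkZu /B3 zyE zaE' zzE mkZx mkZu.
- move=> p.
  have zyE : zy (psi p) = zy p by apply: functional_extensionality => i; rewrite mkZy.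
  have zaE' : za (psi p) = za p by rewrite /za mkZv mkV_l.
  have zzE : zz (psi p) = B2 p by rewrite /zz mkZv mkV_r.
  have xz : zx p * Y (zy p) = za p * zz p ^+ e + 1 by rewrite -ymon1 zaE.
  have [E1 E2 E3] := fwdK e0 q1 series (YlYr (zy p)) (YdYr (zy p)) (zu p) xz.
  apply: Z_ext.
  + by rewrite mkZx /F1 zyE zaE' zzE mkZx mkZu.
  + by move=> i; rewrite mkZy zyE.
  + by rewrite mkZv /F2 zyE zzE mkZu mkZv mkV_l E2 mkVE.
  + by rewrite mkZu /F3 zyE zaE' zzE mkZx mkZu.
- have rx := @reg_zx _ _ _ f _ l; have ry := @reg_zy _ _ _ f _ l.
  have ru := @reg_zu _ _ _ f _ l; have rz := @reg_zz l; have ra := @reg_za l.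
  have rY : regular_fun (fun p : pt (suspline f l) => Y (zy p)).
    by apply: reg_prod => i _; apply: ry.
  have rYd : regular_fun (fun p : pt (suspline f l) => Yd (zy p)).
    by apply: reg_prod => i _; apply: regX; apply: ry.
  have rYr : regular_fun (fun p : pt (suspline f l) => Yr (zy p)).
    by apply: reg_prod => i _; apply: regX; apply: ry.
  have rF2 : regular_fun F2 by rewrite /F2 /fwdz; regular.
  have rF1 : regular_fun F1 by rewrite /F1 /fwdx /dq; regular.
  apply: regmap_Z.
  + by apply: (reg_ext rF1) => p; rewrite mkZx.
  + by move=> i; apply: (reg_ext (ry i)) => p; rewrite mkZy.
  + have := regmap_mkV (regmap_comp (@regmap_zv _ _ _ f _ l) (regmap_l W _)) rF2.
    by move=> rV j; apply: (reg_ext (rV j)) => p; rewrite mkZv.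
  + have rF3 : regular_fun F3.
      rewrite /F3 /fwdt /corr /shift /rest /dh; regular.
    by apply: (reg_ext rF3) => p; rewrite mkZu.
- have rx := @reg_zx _ _ _ f _ l1; have ry := @reg_zy _ _ _ f _ l1.
  have ru := @reg_zu _ _ _ f _ l1; have rz := @reg_zz l1; have ra := @reg_za l1.
  have rY : regular_fun (fun p : pt (suspline f l1) => Y (zy p)).
    by apply: reg_prod => i _; apply: ry.
  have rYd : regular_fun (fun p : pt (suspline f l1) => Yd (zy p)).
    by apply: reg_prod => i _; apply: regX; apply: ry.
  have rYr : regular_fun (fun p : pt (suspline f l1) => Yr (zy p)).
    by apply: reg_prod => i _; apply: regX; apply: ry.
  have rB2 : regular_fun B2 by rewrite /B2 /bwdz /dh; regular.
  apply: regmap_Z.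
  + have rB1 : regular_fun B1 by rewrite /B1 /bwdx /dq /bwdz /dh; regular.
    by apply: (reg_ext rB1) => p; rewrite mkZx.
  + by move=> i; apply: (reg_ext (ry i)) => p; rewrite mkZy.
  + have := regmap_mkV (regmap_comp (@regmap_zv _ _ _ f _ l1) (regmap_l W _)) rB2.
    by move=> rV j; apply: (reg_ext (rV j)) => p; rewrite mkZv.
  + have rB3 : regular_fun B3 by rewrite /B3 /bwds; regular.
    by apply: (reg_ext rB3) => p; rewrite mkZu.
Qed.

End Danielewski.

(** * Families of characters *)

Section WeightComponent.
Variables (K : closedFieldType) (charK0 : [pchar K] =i pred0).

(** The coefficients of the character w agree, by independence. *)
Lemma weight_component d (I : eqType) (s : seq I) (c : I -> 'rV[int]_d)
    (F : I -> K) (G : K) (w : 'rV[int]_d) :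
  (forall t, \sum_(i <- s) F i * wt t (c i) = wt t w * G) ->
  G = \sum_(i <- s | c i == w) F i.
Proof.
move=> sE; pose ws := undup (w :: map c s).
pose a w' := \sum_(i <- s | c i == w') F i - (w' == w)%:R * G.
have ws_uniq : uniq ws by apply: undup_uniq.
have w_ws : w \in ws by rewrite mem_undup mem_head.
have a0 t : \sum_(w' <- ws) a w' * wt t w' = 0.
  rewrite (eq_bigr (fun w' => \sum_(i <- s | c i == w') F i * wt t (c i)
    - (w' == w)%:R * G * wt t w')); last first.
    move=> w' _; rewrite mulrBl mulr_suml; congr (_ - _).
    by apply: eq_bigr => i /eqP ->.
  rewrite sumrB -sum_fibers //; last first.
    by apply/allP => i i_s; rewrite mem_undup inE map_f ?orbT.
  rewrite sE (bigD1_seq w) //= eqxx mul1r big1 ?addr0 => [|w' /negPf ->].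
    by rewrite mulrC subrr.
  by rewrite !mul0r.
have /eqP := characters_indep charK0 ws_uniq a0 w_ws.
by rewrite /a eqxx mul1r subr_eq0 => /eqP ->.
Qed.

(** At every point where f does not vanish, F is a multiple of one character.
    This character does not vary with the point: its coefficient h takes only
    the values 0 and f, so h (h - f) f vanishes, and regular functions on V
    have no zero divisors. *)
Lemma character_family n (V : {pred 'rV[K]_n}) d
    (F : pt (Gm K d) -> pt V -> K) (f : pt V -> K) :
  domain V -> regular_fun f -> (exists v, f v != 0) ->
  regular_fun (fun p => F (proj_l p) (proj_r p)) ->
  (forall v, F (gm1 K d) v = f v) ->
  (forall t v, f v != 0 -> F t v != 0) ->
  exists w, forall t v, F t v = wt t w * f v.
Proof.
move=> domV f_reg [v0 fv0] F_reg F1 Fn0.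
have [ws [h [ws_uniq h_reg hE']]] := laurent_expansion F_reg.
have hE t v : F t v = \sum_(w <- ws) h w v * wt t w.
  by rewrite -hE' pair_ptKl pair_ptKr.
have fE v : f v = \sum_(w <- ws) h w v.
  by rewrite -F1 hE; apply: eq_bigr => w _; rewrite wt1 mulr1.
have single v : f v != 0 ->
    exists2 w0, w0 \in ws & {in ws, forall w, w != w0 -> h w v = 0}.
  move=> fv; apply: (nonvanishing_laurent ws_uniq) => t.
  by rewrite -hE Fn0.
have single0 v w0 : w0 \in ws -> {in ws, forall w, w != w0 -> h w v = 0} ->
    h w0 v = f v.
  move=> ws0 h0; rewrite fE (bigD1_seq w0) //= big_seq_cond big1 ?addr0 //.
  by move=> w /andP[ws_w ww0]; apply: h0.
have [w0 ws0 hw0] := single v0 fv0.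
have hw0v0 : h w0 v0 != 0 by rewrite (single0 v0 w0).
have hw0E v : h w0 v = f v.
  apply/eqP; rewrite -subr_eq0; apply: contraT => hfv.
  have [|v1] := domV (h w0) (fun v => h w0 v - f v) (h_reg w0) _ (ex_intro _ v0 hw0v0)
    (ex_intro _ v hfv); first exact: regB.
  move=> nz1; have [|v2] := domV (fun v => h w0 v * (h w0 v - f v)) f _ f_reg
    (ex_intro _ v1 nz1) (ex_intro _ v0 fv0).
    by apply: regM => //; apply: regB.
  move=> nz; have fv2 : f v2 != 0 by move: nz; rewrite mulf_eq0 negb_or => /andP[].
  have [w1 ws1 hw1] := single v2 fv2; move: nz.
  have [<-|w01] := eqVneq w1 w0; first by rewrite single0 // subrr mulr0 mul0r eqxx.
  by rewrite (hw1 w0) ?mul0r ?eqxx // eq_sym.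
exists w0 => t v; rewrite mulrC -hw0E hE (bigD1_seq w0) //=.
rewrite big_seq_cond big1 ?addr0 // => w /andP[ws_w ww0].
suff -> : h w v = 0 by rewrite mul0r.
apply/eqP; apply: contraT => hwv.
have [v1] := domV _ _ (h_reg w) f_reg (ex_intro _ v hwv) (ex_intro _ v0 fv0).
rewrite mulf_eq0 negb_or => /andP[hwv1 fv1].
have [w1 ws1 hw1] := single v1 fv1.
have [w1w|w1w] := eqVneq w w1; last by rewrite hw1 // eqxx in hwv1.
by move: fv1; rewrite -hw0E hw1 ?eqxx // -w1w eq_sym.
Qed.

End WeightComponent.

(** * Weights on a suspension *)

Section SuspensionTorus.
Variables (K : closedFieldType) (charK0 : [pchar K] =i pred0).
Variables (n : nat) (V : {pred 'rV[K]_n}) (f : pt V -> K).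
Hypothesis f_reg : regular_fun f.
Variables (m : nat) (l : m.-tuple nat).

Local Notation Z := (suspline f l).

Lemma sec_subproof v : f v * ymon l (fun=> 1) = f v.
Proof. by rewrite /ymon big1 ?mulr1 // => i _; rewrite expr1n. Qed.

(** A section of the projection to V; it meets all orbits of the scalings of
    the y_i and of u on which these coordinates do not vanish. *)
Definition sec (v : pt V) : pt Z := mkZ 1 (sec_subproof v).

Lemma regmap_sec : regular_map sec.
Proof.
apply: regmap_Z => [|i|j|].
- by apply: (reg_ext f_reg) => v; rewrite mkZx.
- by apply: (reg_ext (reg_cst _ 1)) => v; rewrite mkZy.
- by apply: (reg_ext (reg_coord _ j)) => v; rewrite mkZv.
- by apply: (reg_ext (reg_cst _ 1)) => v; rewrite mkZu.
Qed.

Lemma ymon_neq0 (y : 'I_m -> K) : (forall i, y i != 0) -> ymon l y != 0.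
Proof. by move=> y0; apply/prodf_neq0 => i _; apply: expf_neq0. Qed.

Lemma scale_subproof (g : pt V -> pt V) (s : 'I_m -> K) (p : pt Z) :
  (forall v, f (g v) = f v) -> (forall i, s i != 0) ->
  ((ymon l s)^-1 * zx p) * ymon l (fun i => s i * zy p i) = f (g (zv p)).
Proof. by move=> gf s0; rewrite ymonM mulrACA mulVf ?mul1r ?zeqn ?gf ?ymon_neq0. Qed.

Section Weights.

(** The monomial x^a y^b u^c has weight c, b - a l. *)
Definition zweight (M : 'X_{1..m.+1 + n + 1}) : 'rV[int]_(m.+1) :=
  \row_i (if unlift ord0 i is Some j then
     (M (lshift 1 (lshift n (lift ord0 j))))%:Z
       - (M (lshift 1 (lshift n ord0)) * tnth l j)%N%:Z
   else (M (rshift (m.+1 + n) ord0))%:Z).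

Definition scaled (t : pt (Gm K m.+1)) (p q : pt Z) : Prop :=
  [/\ zx q = (ymon l (fun i => gmv t (lift ord0 i)))^-1 * zx p,
      forall i, zy q i = gmv t (lift ord0 i) * zy p i, zv q = zv p
    & zu q = gmv t ord0 * zu p].

Definition zterm (P : {mpoly K[m.+1 + n + 1]}) (M : 'X_{1..m.+1 + n + 1}) (p : pt Z) : K :=
  P@_M * \prod_(j < n) val (zv p) 0 j ^+ M (lshift 1 (rshift m.+1 j))
  * (zx p ^+ M (lshift 1 (lshift n ord0))
     * \prod_i zy p i ^+ M (lshift 1 (lshift n (lift ord0 i)))
     * zu p ^+ M (rshift (m.+1 + n) ord0)).

Lemma meval_zterm P (p : pt Z) : P.@[val p 0] = \sum_(M <- msupp P) zterm P M p.
Proof.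
rewrite mevalE; apply: eq_bigr => M _; rewrite /zterm -mulrA; congr (_ * _).
rewrite big_split_ord big_ord1 /= mulrA; congr (_ * _).
rewrite big_split_ord big_ord_recl /= mulrC; congr (_ * _).
by apply: eq_bigr => j _; rewrite zvE.
Qed.

Lemma zterm_scaled P M t p q :
  scaled t p q -> zterm P M q = zterm P M p * wt t (zweight M).
Proof.
case=> qx qy qv qu; rewrite /zterm qv qx qu -[RHS]mulrA; congr (_ * _).
rewrite !exprMn (eq_bigr (fun i => gmv t (lift ord0 i) ^+ M (lshift 1 (lshift n (lift ord0 i)))
   * zy p i ^+ M (lshift 1 (lshift n (lift ord0 i))))); last first.
  by move=> i _; rewrite qy exprMn.
rewrite big_split /wt big_ord_recl mxE unlift_none /=.
set a := M _; have -> : \prod_i gmv t (lift ord0 i) ^ zweight M 0 (lift ord0 i) =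
    \prod_i gmv t (lift ord0 i) ^+ M (lshift 1 (lshift n (lift ord0 i)))
    * (ymon l (fun i => gmv t (lift ord0 i)))^-1 ^+ a.
  rewrite -prodfV -prodrXl -big_split; apply: eq_bigr => i _ /=.
  rewrite /zweight mxE liftK expfzDr ?gmv_neq0 //.
  by rewrite -exprnP -exprnN mulnC exprM exprVn.
by rewrite -exprnP; ring.
Qed.

Lemma scaled_exists t (p : pt Z) : exists q, scaled t p q.
Proof.
have t0 i : gmv t (lift ord0 i) != 0 by apply: gmv_neq0.
exists (mkZ (gmv t ord0 * zu p) (scale_subproof p (fun v => erefl (f v)) t0)).
by split=> [|i||]; rewrite ?mkZx ?mkZy ?mkZv ?mkZu.
Qed.

Lemma weight_zterms P (G : pt Z -> K) w (p : pt Z) :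
  (forall q, G q = P.@[val q 0]) ->
  (forall t q, scaled t p q -> G q = wt t w * G p) ->
  G p = \sum_(M <- msupp P | zweight M == w) zterm P M p.
Proof.
move=> GP Gw; apply: (weight_component charK0) => t.
have [q pq] := scaled_exists t p.
rewrite -(Gw t q pq) GP meval_zterm; apply: eq_bigr => M _.
by rewrite (zterm_scaled P M pq).
Qed.

(** The monomials of this weight are u^c y^b times a power of x y^l = f(v). As
    the identity also has to hold where some y_i vanish, it cannot be deduced
    from the orbits through the section alone. *)
Lemma nonneg_weight_sec (c : nat) (b : 'I_m -> nat) (G : pt Z -> K) (p : pt Z) :
  regular_fun G ->
  (forall t p q, scaled t p q ->
     G q = gmv t ord0 ^+ c * \prod_i gmv t (lift ord0 i) ^+ b i * G p) ->
  G p = zu p ^+ c * \prod_i zy p i ^+ b i * G (sec (zv p)).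
Proof.
case=> P GP Gw.
pose w : 'rV[int]_m.+1 := \row_i (if unlift ord0 i is Some j then (b j)%:Z else c%:Z).
have wE t : wt t w = gmv t ord0 ^+ c * \prod_i gmv t (lift ord0 i) ^+ b i.
  rewrite /wt big_ord_recl mxE unlift_none; congr (_ * _).
  by apply: eq_bigr => i _; rewrite mxE liftK.
have {}Gw t p1 q : scaled t p1 q -> G q = wt t w * G p1 by rewrite wE; apply: Gw.
have GE q : G q = \sum_(M <- msupp P | zweight M == w) zterm P M q.
  by apply: weight_zterms GP _ => t q'; apply: Gw.
rewrite [LHS]GE [in RHS]GE mulr_sumr; apply: eq_bigr => M /eqP/rowP Mw.
have := Mw ord0; rewrite !mxE unlift_none => -[Mc].
rewrite /zterm Mc mkZv mkZx mkZu expr1n mulr1.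
set a := M (lshift 1 (lshift n ord0)).
have My i : M (lshift 1 (lshift n (lift ord0 i))) = (a * tnth l i + b i)%N.
  have := Mw (lift ord0 i); rewrite !mxE liftK -/a => /eqP.
  by rewrite subr_eq addrC -PoszD => /eqP[->]; rewrite addnC.
rewrite [\prod_i zy (sec _) i ^+ _]big1 ?mulr1; last by move=> i _; rewrite mkZy expr1n.
rewrite -zeqn exprMn -prodrXl.
rewrite (eq_bigr (fun i => (zy p i ^+ tnth l i) ^+ a * zy p i ^+ b i)); last first.
  by move=> i _; rewrite My exprD mulnC exprM.
by rewrite big_split /=; ring.
Qed.

(** A monomial x^a y^b of the weight of x has b = (a - 1) l, so that a is positive
    and the monomial is x f(v)^(a - 1). *)
Lemma x_weight (G : pt Z -> K) : (0 < m)%N -> (forall i, (0 < tnth l i)%N) ->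
  regular_fun G ->
  (forall t p q, scaled t p q ->
     G q = (ymon l (fun i => gmv t (lift ord0 i)))^-1 * G p) ->
  exists2 k, regular_fun k & forall p, G p = zx p * k (zv p).
Proof.
move=> m_gt0 l_gt0 [P GP] Gw.
pose w : 'rV[int]_m.+1 :=
  \row_i (if unlift ord0 i is Some j then - (tnth l j)%:Z else 0).
have wE t : wt t w = (ymon l (fun i => gmv t (lift ord0 i)))^-1.
  rewrite /wt big_ord_recl mxE unlift_none expr0z mul1r -prodfV.
  by apply: eq_bigr => i _; rewrite mxE liftK exprnN.
have {}Gw t p1 q : scaled t p1 q -> G q = wt t w * G p1 by rewrite wE; apply: Gw.
pose a (M : 'X_{1..m.+1 + n + 1}) := M (lshift 1 (lshift n ord0)).
exists (fun v : pt V => \sum_(M <- msupp P | zweight M == w)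
  P@_M * \prod_(j < n) val v 0 j ^+ M (lshift 1 (rshift m.+1 j)) * f v ^+ (a M).-1).
  apply: reg_sum => M _; apply: regM; last exact: regX.
  by apply: regM; [exact: reg_cst | apply: reg_prod => j _; apply/regX/reg_coord].
move=> p; have -> : G p = \sum_(M <- msupp P | zweight M == w) zterm P M p.
  by apply: weight_zterms GP _ => t q; apply: Gw.
rewrite mulr_sumr; apply: eq_bigr => M /eqP/rowP Mw.
have := Mw ord0; rewrite !mxE unlift_none => -[Mc].
have My i : (M (lshift 1 (lshift n (lift ord0 i))) + tnth l i = a M * tnth l i)%N.
  have := Mw (lift ord0 i); rewrite !mxE liftK -/(a M); lia.
have aM : a M = (a M).-1.+1.
  case: (a M) (My (Ordinal m_gt0)) => //; have := l_gt0 (Ordinal m_gt0); lia.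
rewrite /zterm Mc -/(a M) {1}aM expr0 mulr1 -zeqn exprMn -prodrXl exprS.
rewrite (eq_bigr (fun i => (zy p i ^+ tnth l i) ^+ (a M).-1)); last first.
  move=> i _; rewrite -exprM; congr (_ ^+ _); have := My i; rewrite aM /=; lia.
by ring.
Qed.

End Weights.
End SuspensionTorus.

(** * The torus of a suspension *)

Lemma reg_gmvV (K : closedFieldType) d (i : 'I_d) :
  regular_fun (fun t : pt (Gm K d) => (gmv t i)^-1).
Proof. by apply: (reg_ext (reg_coord _ (rshift d i))) => t; rewrite gmv_inv. Qed.

Section ExtendedTorus.
Variables (K : closedFieldType) (charK0 : [pchar K] =i pred0).
Variables (n : nat) (V : {pred 'rV[K]_n}) (f : pt V -> K).
Hypothesis f_reg : regular_fun f.
Variables (m : nat) (l : m.-tuple nat).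
Variables (d : nat) (T : (pt V -> pt V) -> Prop) (rho : pt (Gm K d) -> pt V -> pt V).
Hypothesis iso : torus_iso T rho.
Hypothesis f_inv : forall t v, f (rho t v) = f v.
Variable v0 : pt V.

Local Notation Z := (suspline f l).

(** In the torus of dimension d + m + 1 the first d coordinates act on V, the
    next one scales u, and the last m scale the y_i. *)
Definition gT (t : pt (Gm K (d + m.+1))) : pt (Gm K d) := gmpow (row_mx 1%:M 0) t.
Definition gu (t : pt (Gm K (d + m.+1))) : K := gmv t (rshift d ord0).
Definition gy (t : pt (Gm K (d + m.+1))) (i : 'I_m) : K :=
  gmv t (rshift d (lift ord0 i)).

Definition mkT (t : pt (Gm K d)) (r : K) (s : 'I_m -> K) : pt (Gm K (d + m.+1)) :=
  mkgm (fun i => match split i with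
    | inl j => gmv t j
    | inr j => oapp s r (unlift ord0 j) end).

Lemma gTE t i : gmv (gT t) i = gmv t (lshift m.+1 i).
Proof.
rewrite gmv_pow row_row_mx row1 row0 -(wt_delta t); congr (wt t _).
apply/rowP => j; case: (split_ordP j) => {j} j ->.
  by rewrite row_mxEl !mxE (inj_eq (@lshift_inj _ _)).
by rewrite row_mxEr !mxE eq_rlshift andbF.
Qed.

Lemma gy_neq0 t i : gy t i != 0. Proof. exact: gmv_neq0. Qed.

Lemma mkT_T t r s : gT (mkT t r s) = t.
Proof.
apply: gm_ext => i; have lt : split (lshift m.+1 i) = inl i.
  exact: (unsplitK (inl i)).
by rewrite gTE mkgmE lt ?gmv_neq0.
Qed.

Lemma mkT_u t r s : r != 0 -> gu (mkT t r s) = r.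
Proof.
move=> r0; have rt : split (rshift d (@ord0 m)) = inr ord0.
  exact: (unsplitK (inr ord0)).
by rewrite /gu mkgmE rt unlift_none.
Qed.

Lemma mkT_y t r s i : (forall i, s i != 0) -> gy (mkT t r s) i = s i.
Proof.
move=> s0; have rt : split (rshift d (lift ord0 i)) = inr (lift ord0 i).
  exact: (unsplitK (inr (lift ord0 i))).
by rewrite /gy mkgmE rt liftK /= ?s0.
Qed.

Definition rhoZ (t : pt (Gm K (d + m.+1))) (p : pt Z) : pt Z :=
  mkZ (gu t * zu p) (scale_subproof p (f_inv (gT t)) (gy_neq0 t)).

Definition TZ : (pt Z -> pt Z) -> Prop := fun phi => exists t, phi = rhoZ t.

Lemma rhoZ_action : regular_action rhoZ.
Proof.
have act := torus_iso_action iso.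
have rt i : regular_fun (fun u : pt (prod_var (Gm K (d + m.+1)) Z) => gmv (proj_l u) i).
  exact: (reg_comp (regmap_l _ Z) (reg_gmv i)).
have rtV i : regular_fun (fun u : pt (prod_var (Gm K (d + m.+1)) Z) => (gmv (proj_l u) i)^-1).
  exact: (reg_comp (regmap_l _ Z) (@reg_gmvV K _ i)).
split=> [s t p|p|].
- apply: Z_ext => [|i||]; rewrite ?mkZx ?mkZy ?mkZv ?mkZu.
  + rewrite mulrA -invfM -ymonM; congr ((ymon l _)^-1 * _); apply: functional_extensionality => i.
    by rewrite /gy gmvM.
  + by rewrite /gy gmvM mulrA.
  + by rewrite /gT gmpow_mul (action_mul act).
  + by rewrite /gu gmvM mulrA.
- apply: Z_ext => [|i||]; rewrite ?mkZx ?mkZy ?mkZv ?mkZu.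
  + rewrite /ymon big1 ?invr1 ?mul1r // => i _.
    by rewrite /gy gmv1 expr1n.
  + by rewrite /gy gmv1 mul1r.
  + by rewrite /gT gmpow1 (action_one act).
  + by rewrite /gu gmv1 mul1r.
apply: regmap_Z => [|i|j|].
- apply: (@reg_ext _ _ _ (fun u : pt (prod_var (Gm K (d + m.+1)) Z) =>
    \prod_i (gmv (proj_l u) (rshift d (lift ord0 i)))^-1 ^+ tnth l i * zx (proj_r u))).
    apply: regM; last exact: (reg_comp (regmap_r _ Z) (@reg_zx _ _ _ f _ l)).
    by apply: reg_prod => i _; apply: regX.
  move=> u; rewrite mkZx -prodfV; congr (_ * _).
  by apply: eq_bigr => i _; rewrite exprVn.
- apply: (@reg_ext _ _ _ (fun u : pt (prod_var (Gm K (d + m.+1)) Z) =>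
    gmv (proj_l u) (rshift d (lift ord0 i)) * zy (proj_r u) i)).
    by apply: regM => //; apply: (reg_comp (regmap_r _ Z) (@reg_zy _ _ _ f _ l i)).
  by move=> u; rewrite mkZy.
- have rT := regmap_comp (regmap_l (Gm K (d + m.+1)) Z) (regmap_pow (row_mx 1%:M 0)).
  have rV := regmap_comp (regmap_r (Gm K (d + m.+1)) Z) (@regmap_zv _ _ _ f _ l).
  by apply: (reg_ext (regmap_action act rT rV j)) => u; rewrite mkZv.
apply: (@reg_ext _ _ _ (fun u : pt (prod_var (Gm K (d + m.+1)) Z) =>
    gmv (proj_l u) (rshift d ord0) * zu (proj_r u))).
  by apply: regM => //; apply: (reg_comp (regmap_r _ Z) (@reg_zu _ _ _ f _ l)).
by move=> u; rewrite mkZu.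
Qed.

Lemma rhoZ_inj : injective rhoZ.
Proof.
have [_ _ rho_inj _ _] := iso.
move=> s t st; have stE p : rhoZ s p = rhoZ t p by rewrite st.
apply: gm_ext => i; case: (split_ordP i) => {i} i ->.
  rewrite -!gTE; congr (gmv _ i); apply: rho_inj.
  apply: functional_extensionality => v.
  by have := congr1 (@zv _ _ _ _ _ _) (stE (sec f l v)); rewrite !mkZv.
case: (unliftP ord0 i) => [j|] ->.
  have := congr1 (fun p => zy p j) (stE (sec f l v0)).
  by rewrite !mkZy !mulr1.
have := congr1 (@zu _ _ _ _ _ _) (stE (sec f l v0)).
by rewrite !mkZu !mulr1.
Qed.

Lemma TZ_iso : torus_iso TZ rhoZ.
Proof.
split=> [t|s t||j|phi] //.
- exact: action_automorphism rhoZ_action t.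
- by apply: functional_extensionality => p; rewrite (action_mul rhoZ_action).
- exact: rhoZ_inj.
- exact: (action_reg rhoZ_action j).
Qed.

Lemma TZ_torus : torus TZ.
Proof. by exists (d + m.+1)%N, rhoZ; apply: TZ_iso. Qed.

Lemma rhoZ_scaled (s : pt (Gm K m.+1)) (p q : pt Z) :
  scaled s p q ->
  q = rhoZ (mkT (gm1 K d) (gmv s ord0) (fun i => gmv s (lift ord0 i))) p.
Proof.
have act := torus_iso_action iso.
have gyE i : gy (mkT (gm1 K d) (gmv s ord0) (fun i => gmv s (lift ord0 i))) i =
    gmv s (lift ord0 i) by apply: mkT_y => j; apply: gmv_neq0.
case=> qx qy qv qu; apply: Z_ext => [|i||].
- rewrite mkZx qx; congr ((ymon l _)^-1 * _).
  by apply: functional_extensionality => i; rewrite gyE.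
- by rewrite mkZy qy gyE.
- by rewrite mkZv qv mkT_T (action_one act).
- by rewrite mkZu qu mkT_u ?gmv_neq0.
Qed.

End ExtendedTorus.

(** * Maximality *)

Section Maximality.
Variables (K : closedFieldType) (charK0 : [pchar K] =i pred0).
Variables (n : nat) (V : {pred 'rV[K]_n}) (f : pt V -> K).
Hypothesis domV : domain V.
Hypothesis f_reg : regular_fun f.
Variables (m : nat) (l : m.-tuple nat).
Hypothesis m_gt0 : (0 < m)%N.
Hypothesis l_gt0 : forall i, (0 < tnth l i)%N.
Variables (d : nat) (T : (pt V -> pt V) -> Prop) (rho : pt (Gm K d) -> pt V -> pt V).
Hypothesis iso : torus_iso T rho.
Hypothesis f_inv : forall t v, f (rho t v) = f v.
Variable v0 : pt V.
Hypothesis fv0 : f v0 != 0.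
Hypothesis T_max : forall That, torus That -> torus_sub T That ->
  (forall phi, That phi -> exists c, forall v, f (phi v) = c * f v) ->
  torus_sub That T.

Local Notation Z := (suspline f l).
Local Notation sec := (sec f l).

Let domV1 : forall f1 : pt V -> K, regular_fun f1 ->
  (forall v, f1 v * f v = 0) -> forall v, f1 v = 0.
Proof.
move=> f1 f1_reg f1f v; apply/eqP; apply: contraT => f1v.
have [v' /negP[]] := domV f1_reg f_reg (ex_intro _ v f1v) (ex_intro _ v0 fv0).
by rewrite f1f.
Qed.

(** A torus containing [TZ] commutes with the scalings of x, the y_i and u, so
    its elements preserve the weights: they act on V (by [bar]) and multiply
    each of x, y_i and u by functions of v. *)
Section Bigger.
Variables (d' : nat) (T' : (pt Z -> pt Z) -> Prop) (rho' : pt (Gm K d') -> pt Z -> pt Z).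
Hypothesis iso' : torus_iso T' rho'.
Hypothesis TT' : torus_sub (TZ (l := l) f_inv) T'.

Let act' := torus_iso_action iso'.

Definition bar (th : pt (Gm K d')) (v : pt V) : pt V := zv (rho' th (sec v)).
Definition cy (i : 'I_m) (th : pt (Gm K d')) (v : pt V) : K := zy (rho' th (sec v)) i.
Definition cu (th : pt (Gm K d')) (v : pt V) : K := zu (rho' th (sec v)).

Lemma scaled_commute th s (p q : pt Z) :
  scaled s p q -> scaled s (rho' th p) (rho' th q).
Proof.
have [_ _ _ _ T'E] := iso'.
move=> /(rhoZ_scaled iso f_inv) ->; set t := mkT _ _ _.
have -> : rho' th (rhoZ f_inv t p) = rhoZ f_inv t (rho' th p).
  have /T'E[th' ->] : T' (rhoZ f_inv t) by apply: TT'; exists t.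
  by rewrite -!(action_mul act') Gm_mulC.
have [q' pq'] := scaled_exists s (rho' th p).
by rewrite -(rhoZ_scaled iso f_inv pq').
Qed.

Let reg_rho' (th : pt (Gm K d')) : regular_map (rho' th).
Proof. by have [psi []] := action_automorphism act' th. Qed.

Lemma zv_rho' th (p : pt Z) : zv (rho' th p) = bar th (zv p).
Proof.
apply: pt_ext => j.
transitivity (zu p ^+ 0 * \prod_i zy p i ^+ 0 * val (bar th (zv p)) 0 j); last first.
  by rewrite big1 // expr0 !mul1r.
apply: (@nonneg_weight_sec _ charK0 _ _ f _ l 0 (fun=> 0%N)
  (fun p => val (zv (rho' th p)) 0 j)).
  exact: (reg_comp (regmap_comp (reg_rho' th) (@regmap_zv _ _ _ f _ l)) (reg_coord _ j)).
move=> t p1 q1 /(scaled_commute th)[_ _ -> _].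
by rewrite expr0 big1 ?mul1r.
Qed.

Lemma zy_rho' th (p : pt Z) i : zy (rho' th p) i = zy p i * cy i th (zv p).
Proof.
have delta (y : 'I_m -> K) : \prod_j y j ^+ (j == i) = y i.
  rewrite (bigD1 i) //= eqxx expr1 big1 ?mulr1 // => j /negPf ->.
  by rewrite expr0.
transitivity (zu p ^+ 0 * \prod_j zy p j ^+ (j == i) * cy i th (zv p)); last first.
  by rewrite expr0 delta mul1r.
apply: (@nonneg_weight_sec _ charK0 _ _ f _ l 0 (fun j => (j == i : nat))
  (fun p => zy (rho' th p) i)).
  exact: (reg_comp (reg_rho' th) (@reg_zy _ _ _ f _ l i)).
move=> t p1 q1 /(scaled_commute th)[_ -> _ _].
by rewrite expr0 (delta (fun j => gmv t (lift ord0 j))) mul1r.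
Qed.

Lemma zu_rho' th (p : pt Z) : zu (rho' th p) = zu p * cu th (zv p).
Proof.
transitivity (zu p ^+ 1 * \prod_i zy p i ^+ 0 * cu th (zv p)); last first.
  by rewrite big1 // expr1 mulr1.
apply: (@nonneg_weight_sec _ charK0 _ _ f _ l 1 (fun=> 0%N)
  (fun p => zu (rho' th p))).
  exact: (reg_comp (reg_rho' th) (@reg_zu _ _ _ f _ l)).
move=> t p1 q1 /(scaled_commute th)[_ _ _ ->].
by rewrite expr1 big1 ?mulr1.
Qed.

Lemma zx_rho' th : exists2 k, regular_fun k & forall p, zx (rho' th p) = zx p * k (zv p).
Proof.
apply: (x_weight charK0 f_reg m_gt0 l_gt0).
  exact: (reg_comp (reg_rho' th) (@reg_zx _ _ _ f _ l)).
by move=> t p1 q1 /(scaled_commute th)[-> _ _ _].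
Qed.

Lemma bar_action : regular_action bar.
Proof.
split=> [s t v|v|].
- by rewrite {1}/bar (action_mul act') zv_rho'.
- by rewrite /bar (action_one act') mkZv.
have rsec := regmap_comp (regmap_r (Gm K d') V) (regmap_sec f_reg l).
exact: (regmap_comp (regmap_action act' (regmap_l _ V) rsec) (@regmap_zv _ _ _ f _ l)).
Qed.

Let reg_rho_sec (F : pt Z -> K) : regular_fun F ->
  regular_fun (fun u : pt (prod_var (Gm K d') V) => F (rho' (proj_l u) (sec (proj_r u)))).
Proof.
have rsec := regmap_comp (regmap_r (Gm K d') V) (regmap_sec f_reg l).
exact: (reg_comp (regmap_action act' (regmap_l _ V) rsec)).
Qed.

(** The factor of y_i is a nowhere vanishing regular function, hence, as the
    torus varies, a character. *)
Lemma cy_char i : exists w, forall th v, cy i th v = wt th w.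
Proof.
have cy1 v : cy i (gm1 K d') v = 1 by rewrite /cy (action_one act') mkZy.
have [|t v _|w wE] := @character_family _ _ V d' (cy i) (fun=> 1) domV (reg_cst _ 1)
  (ex_intro _ v0 (oner_neq0 K)) _ cy1.
- exact: (reg_rho_sec (@reg_zy _ _ _ f _ l i)).
- apply: contra_neq (oner_neq0 K) => c0.
  rewrite -(mkZy 1 (sec_subproof f l v) i) -/(sec v) -(action_invl act' t (sec v)).
  by rewrite zy_rho' -/(cy i t v) c0 mul0r.
by exists w => th v; rewrite wE mulr1.
Qed.

Lemma cu_char : exists w, forall th v, cu th v = wt th w.
Proof.
have cu1 v : cu (gm1 K d') v = 1 by rewrite /cu (action_one act') mkZu.
have [|t v _|w wE] := @character_family _ _ V d' cu (fun=> 1) domV (reg_cst _ 1)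
  (ex_intro _ v0 (oner_neq0 K)) _ cu1.
- exact: (reg_rho_sec (@reg_zu _ _ _ f _ l)).
- apply: contra_neq (oner_neq0 K) => c0.
  rewrite -(mkZu 1 (sec_subproof f l v)) -/(sec v) -(action_invl act' t (sec v)).
  by rewrite zu_rho' -/(cu t v) c0 mul0r.
by exists w => th v; rewrite wE mulr1.
Qed.

Let ymon0 (y : 'I_m -> K) : (forall i, y i = 0) -> ymon l y = 0.
Proof.
move=> y0; rewrite /ymon (bigD1 (Ordinal m_gt0)) //= y0 expr0n.
by have := l_gt0 (Ordinal m_gt0); case: (tnth _ _) => // a _; rewrite mul0r.
Qed.

(** Over a zero v of f there is a point with y = 0, and y stays 0. *)
Lemma bar_zero th v : f v = 0 -> f (bar th v) = 0.
Proof.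
move=> fv; have eqn0 : 0 * ymon l (fun=> 0) = f v by rewrite mul0r.
have := zv_rho' th (mkZ 0 eqn0); rewrite mkZv => <-.
rewrite -zeqn ymon0 ?mulr0 // => i.
by rewrite zy_rho' mkZy mul0r.
Qed.

Lemma f_bar : exists w, forall th v, f (bar th v) = wt th w * f v.
Proof.
apply: (character_family (F := fun th v => f (bar th v)) domV f_reg (ex_intro _ v0 fv0)).
- exact: (reg_comp (action_reg bar_action) f_reg).
- by move=> v; rewrite (action_one bar_action).
- move=> t v; apply: contra_neq => /(bar_zero (gm_inv t)).
  by rewrite (action_invl bar_action).
Qed.

(** The torus induced on V multiplies f by a character, so it is [T]; the
    equation x y^l = f(v) then determines the factor of x. *)
Lemma bigger_sub : torus_sub T' (TZ (l := l) f_inv).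
Proof.
have [_ _ _ _ T'E] := iso'; have [_ _ _ _ TE] := iso.
pose That := fun phi : pt V -> pt V => exists th, phi = bar th.
have That_torus : torus That.
  have [q [chi [g [A eig]]]] := eigen_coordinates_exist charK0 bar_action.
  exact: (image_torus bar_action eig).
have T_That : torus_sub T That.
  move=> _ /TE[t ->].
  pose t' := mkT t 1 (fun _ : 'I_m => 1).
  have /T'E[th tE] : T' (rhoZ f_inv t') by apply: TT'; exists t'.
  exists th; apply: functional_extensionality => v.
  by rewrite /bar -tE mkZv mkZv mkT_T.
have [w wE] := f_bar.
have That_T : torus_sub That T.
  by apply: T_max => // _ [th ->]; exists (wt th w).
move=> _ /T'E[th ->]; have /That_T/TE[t tE] : That (bar th) by exists th.
have [wy wyE] := choice _ cy_char; have [wu wuE] := cu_char.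
have [k k_reg kE] := zx_rho' th.
pose s i := wt th (wy i).
have s0 i : s i != 0 by apply: wt_neq0.
exists (mkT t (wt th wu) s).
have kC v : k v = (ymon l s)^-1.
  suff /(_ v)/eqP : forall v, k v * ymon l s - 1 = 0.
    rewrite subr_eq0 => /eqP ks; apply: (mulIf (ymon_neq0 l s0)).
    by rewrite ks mulVf ?ymon_neq0.
  apply: domV1 => [|{}v].
    by apply: regB; [apply: regM => //|]; apply: reg_cst.
  have := zeqn (rho' th (sec v)); rewrite kE mkZx mkZv -/(bar th v) tE f_inv.
  have -> : zy (rho' th (sec v)) = s.
    by apply: functional_extensionality => i; rewrite -/(cy i th v) wyE.
  by move=> fk; rewrite mulrBl mul1r -{2}fk; ring.
apply: functional_extensionality => p; apply: Z_ext => [|i||].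
- rewrite kE kC mkZx mulrC; congr ((ymon l _)^-1 * _).
  by apply: functional_extensionality => i; rewrite mkT_y.
- by rewrite zy_rho' mkZy mkT_y // wyE mulrC.
- by rewrite zv_rho' mkZv mkT_T tE.
- by rewrite zu_rho' mkZu mkT_u ?wt_neq0 // wuE mulrC.
Qed.

End Bigger.

Lemma TZ_maximal : maximal_torus (TZ (l := l) f_inv).
Proof.
split; first exact: (TZ_torus l iso f_inv v0).
case=> T' [[d' [rho' iso']] [TT' nT'T]]; apply: nT'T.
exact: (bigger_sub iso' TT').
Qed.

End Maximality.

(** * Components of stabilizers *)

Lemma closed_prim_root (K : closedFieldType) N : [pchar K] =i pred0 -> (0 < N)%N ->
  exists z : K, N.-primitive_root z.
Proof.
move=> K0 N0; have [r rE] := closed_field_poly_normal ('X^N - 1 : {poly K}).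
have lead1 : lead_coef ('X^N - 1 : {poly K}) = 1.
  by have := monicXnsubC (1 : K) N0; rewrite polyC1 monicE => /eqP.
rewrite lead1 scale1r in rE.
have r_size : size r = N.
  have := congr1 (fun p : {poly K} => size p) rE.
  by have := size_XnsubC (1 : K) N0; rewrite polyC1 size_prod_XsubC => -> [].
have r_uniq : uniq r.
  rewrite -separable_prod_XsubC -rE separable_Xn_sub_1 //.
  by have /pcharf0P -> := K0; rewrite -lt0n.
have r_root : all N.-unity_root r.
  apply/allP => z zr; rewrite unity_rootE -subr_eq0.
  have : root ('X^N - 1) z by rewrite rE root_prod_XsubC.
  by rewrite /root !(hornerE, hornerXn).
have /hasP[z _ zN] := has_prim_root N0 r_root r_uniq (eq_leq (esym r_size)).
by exists z.
Qed.

Section StabilizerLowerBound.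
Variables (K : closedFieldType) (charK0 : [pchar K] =i pred0).
Variables (n : nat) (V : {pred 'rV[K]_n}) (f : pt V -> K).
Variables (m : nat) (i0 : 'I_m) (N : nat).
Hypothesis N_gt0 : (0 < N)%N.
Variables (d : nat) (T : (pt V -> pt V) -> Prop) (rho : pt (Gm K d) -> pt V -> pt V).
Hypothesis iso : torus_iso T rho.
Hypothesis f_inv : forall t v, f (rho t v) = f v.
Variable v1 : pt V.
Hypothesis fv1 : f v1 = 0.

Local Notation l := [tuple of nseq m N].

(** The stabilizer of a point at which only the coordinate y_i vanishes meets
    the torus scaling the y_j in the group of N-th roots of unity. *)
Lemma stabilizer_exponent_dvd e :
  stabilizer_exponent (TZ (l := l) f_inv) e -> (N %| e)%N.
Proof.
move=> stab; have [z zN] := closed_prim_root charK0 N_gt0.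
have act := torus_iso_action iso.
have actZ := @rhoZ_action _ _ _ _ _ l _ _ _ iso f_inv.
have z0 : z != 0.
  apply/eqP => z0; have := prim_expr_order zN.
  by rewrite z0 expr0n eqn0Ngt N_gt0 => /esym/eqP; rewrite oner_eq0.
pose y j : K := if j == i0 then 0 else 1.
have y0 : 1 * ymon l y = f v1.
  rewrite fv1 mul1r /ymon (bigD1 i0) //= /y eqxx expr0n tnth_nseq.
  by rewrite eqn0Ngt N_gt0 mul0r.
pose s j : K := if j == i0 then z else 1.
have s0 j : s j != 0 by rewrite /s; case: ifP; rewrite ?oner_neq0.
have ymon_at (a : 'I_m -> K) : (forall j, j != i0 -> a j = 1) -> ymon l a = a i0 ^+ N.
  move=> a1; rewrite /ymon (bigD1 i0) //= tnth_nseq big1 ?mulr1 // => j /a1 ->.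
  by rewrite expr1n.
pose t := mkT (gm1 K d) 1 s; pose p := mkZ 1 y0.
have gyt : gy t = s by apply: functional_extensionality => j; rewrite mkT_y.
have tp : rhoZ f_inv t p = p.
  apply: Z_ext => [|j||].
  - rewrite !mkZx mulr1 gyt ymon_at; last by move=> j /negPf ji; rewrite /s ji.
    by rewrite /s eqxx (prim_expr_order zN) invr1.
  - by rewrite !mkZy gyt /s /y; case: eqP; rewrite ?mulr0 ?mulr1.
  - by rewrite !mkZv mkT_T (action_one act).
  - by rewrite !mkZu mkT_u ?oner_neq0 ?mulr1.
have [psi [[t' ->] t'p t'N]] := stab p _ N (ex_intro _ t erefl) tp N_gt0.
(* psi fixes p as well, so it can only move y_i0, by a root of unity. *)
have gy1 j : j != i0 -> gy t' j = 1.
  move=> /negPf ji; have := congr1 (fun q => zy q j) t'p.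
  by rewrite !mkZy /y ji mulr1.
have := congr1 (@zx _ _ _ _ _ _) t'p; rewrite !mkZx mulr1 (ymon_at _ gy1).
move=> /(congr1 (@GRing.inv K)); rewrite invrK invr1 => t'1.
have := congr1 (fun q => zy q i0) (t'N (sec f l v1)).
rewrite !(action_iter _ _ _ actZ) !mkZy !mulr1 /gy !gmv_scal -/(gy t' i0) -/(gy t i0).
by rewrite gyt /s eqxx -!exprnP t'1 => /esym/eqP; rewrite -(prim_order_dvd zN).
Qed.

End StabilizerLowerBound.

(** * Transport of tori *)

Section Transport.
Variables (K : closedFieldType) (n1 n2 : nat).
Variables (X1 : {pred 'rV[K]_n1}) (X2 : {pred 'rV[K]_n2}).
Variables (g : pt X1 -> pt X2) (h : pt X2 -> pt X1).
Hypotheses (gK : cancel g h) (hK : cancel h g).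

Definition transport (T : (pt X1 -> pt X1) -> Prop) (phi : pt X2 -> pt X2) : Prop :=
  T (h \o phi \o g).

Lemma stabilizer_exponent_transport T1 (T2 : (pt X2 -> pt X2) -> Prop) e :
  (forall phi, T2 phi <-> transport T1 phi) ->
  stabilizer_exponent T1 e -> stabilizer_exponent T2 e.
Proof.
move=> T2E stab p phi r /T2E T1phi phip r0.
have [|psi [T1psi psip psiE]] := stab (h p) _ r T1phi _ r0; first by rewrite /= hK phip.
have iterE (chi : pt X1 -> pt X1) i x :
    iter i (g \o chi \o h) x = g (iter i chi (h x)).
  by elim: i => [|i IHi]; rewrite /= ?hK // IHi /= gK.
exists (g \o psi \o h); split=> [||x].
- apply/T2E; rewrite /transport (_ : h \o _ \o g = psi) //.
  by apply: functional_extensionality => x /=; rewrite !gK.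
- by rewrite /= psip hK.
rewrite iterE psiE -iterE; elim: e {stab psiE} => //= i ->.
by rewrite !hK.
Qed.

Hypotheses (rg : regular_map g) (rh : regular_map h).

Lemma torus_transport T : torus T -> torus (transport T).
Proof.
case=> d [rho iso]; have [_ _ inj _ TE] := iso.
have act := torus_iso_action iso.
pose rho' t := g \o rho t \o h; exists d, rho'.
have act' : regular_action rho'.
  split=> [s t p|p|].
  - by rewrite /rho' /= gK (action_mul act).
  - by rewrite /rho' /= (action_one act) hK.
  apply: regmap_comp rg; apply: (regmap_action act (regmap_l _ X2)).
  exact: regmap_comp (regmap_r _ X2) rh.
split.
- exact: action_automorphism act'.
- by move=> s t; apply: functional_extensionality => p; rewrite (action_mul act').
- move=> s t st; apply: inj; apply: functional_extensionality => p.
  by have := congr1 (fun phi => h (phi (g p))) st; rewrite /rho' /= !gK.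
- exact: action_reg act'.
move=> phi; split=> [/TE[t tE]|[t ->]].
  exists t; rewrite /rho' -tE; apply: functional_extensionality => p /=.
  by rewrite !hK.
apply/TE; exists t; apply: functional_extensionality => p /=.
by rewrite !gK.
Qed.

End Transport.

Lemma maximal_torus_transport (K : closedFieldType) n1 n2 (X1 : {pred 'rV[K]_n1})
    (X2 : {pred 'rV[K]_n2}) (g : pt X1 -> pt X2) (h : pt X2 -> pt X1) T :
  cancel g h -> cancel h g -> regular_map g -> regular_map h ->
  maximal_torus T -> maximal_torus (transport g h T).
Proof.
move=> gK hK rg rh [torT maxT]; split; first exact: torus_transport.
case=> T' [torT' [TT' nT'T]]; apply: maxT; exists (transport h g T').
have ghgh (phi : pt X1 -> pt X1) : h \o (g \o phi \o h) \o g = phi.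
  by apply: functional_extensionality => p /=; rewrite !gK.
have hghg (phi : pt X2 -> pt X2) : g \o (h \o phi \o g) \o h = phi.
  by apply: functional_extensionality => p /=; rewrite !hK.
split; first exact: torus_transport.
split=> [phi Tphi|T'T]; first by apply: TT'; rewrite /transport ghgh.
apply: nT'T => phi T'phi; apply: T'T.
by rewrite /transport hghg.
Qed.

(** * The product of an irreducible variety with the line *)

Section ProductDomain.
Variables (K : closedFieldType) (charK0 : [pchar K] =i pred0).
Variables (n : nat) (W : {pred 'rV[K]_n}).
Local Notation V := (prod_var W (affine_line K)).

Lemma regular_on_line (F : pt V -> K) (w : pt W) : regular_fun F ->
  exists u : {poly K}, forall c, F (mkV w c) = u.[c].
Proof.
case=> P FP.
pose x (i : 'I_(n + 1)) : {poly K} := if split i is inl j then (val w 0 j)%:P else 'X.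
exists (\sum_(M <- msupp P) P@_M *: \prod_i x i ^+ M i) => c.
rewrite FP mevalE horner_sum; apply: eq_bigr => M _.
rewrite hornerZ horner_prod; congr (_ * _); apply: eq_bigr => i _.
rewrite horner_exp; congr (_ ^+ _).
rewrite /x mxE; case: (split i) => j; first by rewrite hornerC.
by rewrite mxE hornerX.
Qed.

Lemma closed_slice (F : pt V -> K) (c : K) : regular_fun F ->
  exists A : {pred 'rV[K]_n}, zariski_closed A /\
    forall w : pt W, (val w \in A) = (F (mkV w c) == 0).
Proof.
case=> P FP; pose L : {pred 'rV[K]_n} := predT.
pose cst : pt (affine_line K) := exist _ (const_mx c) isT.
have P_reg : regular_fun (fun p : pt (prod_var L (affine_line K)) => P.@[val p 0]).
  by exists P.
have [Q QE] := reg_comp (regmap_pair (regmap_id L) (regmap_cst cst)) P_reg.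
exists (fun w : 'rV[K]_n => Q.@[w 0] == 0); split=> [|w].
  exists (eq Q) => x; rewrite -topredE /=; split=> [/eqP Qx _ <- //|Qx].
  by rewrite Qx.
by rewrite FP -topredE /= -(QE (exist _ (val w) isT)).
Qed.

(** By irreducibility of W there is a line of the product on which neither of
    two given nonzero functions vanishes identically. *)
Lemma domain_line : zariski_irreducible W -> domain V.
Proof.
move=> [_ irr] F G rF rG [v1 Fv1] [v2 Gv2].
have [A [A_closed AE]] := closed_slice (val (proj_r v1) 0 0) rF.
have [B [B_closed BE]] := closed_slice (val (proj_r v2) 0 0) rG.
have [w [wA wB]] : exists w : pt W, val w \notin A /\ val w \notin B.
  apply: NNPP => now; have [x xW||] := irr A B A_closed B_closed.
  - apply: NNPP => nx; apply: now; exists (exist _ x xW).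
    by split; apply/negP => xAB; apply: nx; [left|right].
  - by move=> /(_ _ (valP (proj_l v1))); rewrite AE mkVE (negPf Fv1).
  - by move=> /(_ _ (valP (proj_l v2))); rewrite BE mkVE (negPf Gv2).
have [u uE] := regular_on_line w rF; have [u' u'E] := regular_on_line w rG.
have uu' : u * u' != 0.
  apply: mulf_neq0.
    by apply: contraNneq wA => u0; rewrite AE uE u0 horner0.
  by apply: contraNneq wB => u0; rewrite BE u'E u0 horner0.
have [c _] := nonzero_nonroot charK0 uu'; rewrite hornerM -uE -u'E => FG.
by exists (mkV w c).
Qed.

End ProductDomain.

(** * Conclusion *)

Section FinalChoices.
Variables (K : closedFieldType) (charK0 : [pchar K] =i pred0).

Lemma bounded_max (P : nat -> Prop) b :
  (exists i, P i) -> (forall i, P i -> (i <= b)%N) ->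
  exists2 i, P i & forall j, P j -> (j <= i)%N.
Proof.
elim: b P => [|b IHb] P [i Pi] Pb.
  by exists i => // j /Pb; rewrite leqn0 => /eqP ->.
have [Pb1|nPb1] := classic (P b.+1); first by exists b.+1.
apply: IHb; first by exists i.
move=> j Pj; have := Pb j Pj; rewrite leq_eqVlt => /orP[/eqP jb|//].
by rewrite jb in Pj.
Qed.

(** A torus of largest dimension among those containing [T] and leaving f
    invariant. A torus containing it and multiplying f by a character leaves f
    invariant by the assumption on [T], so it is not larger. *)
Lemma maximal_invariant_torus n (V : {pred 'rV[K]_n}) (f : pt V -> K) (v0 : pt V)
    (T : (pt V -> pt V) -> Prop) :
  domain V -> regular_fun f -> f v0 = 1 -> torus T ->
  (forall phi v, T phi -> f (phi v) = f v) ->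
  ~ (exists That lambda, [/\ torus That, torus_proper T That,
       semi_invariant That f lambda & ~ trivial_on That lambda]) ->
  exists d T1 (rho : pt (Gm K d) -> pt V -> pt V),
  [/\ torus_iso T1 rho, forall t v, f (rho t v) = f v
    & forall That, torus That -> torus_sub T1 That ->
      (forall phi, That phi -> exists c, forall v, f (phi v) = c * f v) ->
      torus_sub That T1].
Proof.
move=> domV f_reg fv0 [dT [rhoT isoT]] f_inv T_max.
pose P d := exists T1 (rho : pt (Gm K d) -> pt V -> pt V),
  [/\ torus_iso T1 rho, torus_sub T T1 & forall t v, f (rho t v) = f v].
have P_T : P dT.
  exists T, rhoT; split=> // t v; apply: f_inv.
  by have [_ _ _ _ ->] := isoT; exists t.
have P_bound d : P d -> (d <= n)%N.
  by case=> T1 [rho [iso _ _]]; apply: (torus_dim_le charK0 domV _ iso); exists v0.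
have [d [T1 [rho [iso TT1 rho_inv]]] d_max] := bounded_max (ex_intro _ _ P_T) P_bound.
exists d, T1, rho; split=> // That [d' [rho' iso']] T1That semi.
have act' := torus_iso_action iso'; have [_ _ _ _ T'E] := iso'.
have semiE phi v : That phi -> f (phi v) = f (phi v0) * f v.
  by move=> /semi[c cE]; rewrite !cE fv0 mulr1.
have rho'_inv t v : f (rho' t v) = f v.
  apply: NNPP => nE.
  have That_t : That (rho' t) by apply/T'E; exists t.
  have lam_t : f (rho' t v0) <> 1.
    by move=> lam1; apply: nE; rewrite semiE // lam1 mul1r.
  pose lambda phi := (f (phi v0))^-1.
  have lamV phi s : phi = rho' s -> f (phi v0) * f (rho' (gm_inv s) v0) = 1.
    move=> ->; rewrite -semiE; last by apply/T'E; exists s.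
    by rewrite (action_invr act').
  have lam_neq0 phi : That phi -> f (phi v0) != 0.
    move=> /T'E[s /lamV e]; apply: contra_eq_neq e => ->.
    by rewrite mul0r eq_sym oner_eq0.
  (* lambda is regular because it is the value of f at the point t^-1 v0. *)
  apply: T_max; exists That, lambda; split.
  - by exists d', rho'.
  - split=> [phi /TT1/T1That //|That_T].
    by apply: lam_t; rewrite f_inv //; apply: That_T.
  - split=> [|phi Tphi x]; last by rewrite semiE // /lambda mulKf ?lam_neq0.
    split=> [phi Tphi|phi psi Tphi Tpsi|].
    + by rewrite /lambda invr_neq0 ?lam_neq0.
    + by rewrite /lambda /= semiE // invfM.
    exists d', rho'; split=> //.
    have r_inv : regular_map (fun s => rho' (gm_inv s) v0).
      exact: (regmap_action act' (regmap_pow (-1%:M)) (regmap_cst v0)).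
    apply: (reg_ext (reg_comp r_inv f_reg)) => s; apply/esym.
    have rs : That (rho' s) by apply/T'E; exists s.
    apply: (mulfI (lam_neq0 _ rs)).
    by rewrite (lamV _ s erefl) /lambda divff ?lam_neq0.
  move=> triv; apply: lam_t; have := triv _ That_t.
  by move=> /(congr1 (@GRing.inv K)); rewrite invrK invr1.
apply: (subtorus_eq charK0 iso iso' _ T1That).
apply: d_max; exists That, rho'; split=> //.
by move=> phi /TT1/T1That.
Qed.

(** Recursively, each member of the sequence exceeds the bounds attached to the
    earlier ones. *)
Lemma escaping_sequence (E : nat -> nat) :
  exists N : nat -> nat, (forall i, (0 < N i)%N) /\
    forall i j, (i < j)%N -> (E (N i) < N j)%N.
Proof.
pose N := fix N i := if i is i'.+1 then (N i' + E (N i')).+1 else 1%N.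
exists N; split=> [[]//|i j]; elim: j => // j IHj.
rewrite ltnS leq_eqVlt => /orP[/eqP ->|/IHj Nj]; first by rewrite /= ltnS leq_addl.
by apply: (ltn_trans Nj); rewrite /= ltnS leq_addr.
Qed.

End FinalChoices.

Theorem theorem5p3 (K : closedFieldType) (charK0 : [pchar K] =i pred0)
    (n : nat) (W : {pred 'rV[K]_n})
    (Wclosed : zariski_closed W) (Wirr : zariski_irreducible W)
    (alpha : pt W -> K) (alpha_reg : regular_fun alpha)
    (alpha_neq0 : exists w, alpha w != 0)
    (k : nat) (k_gt0 : (0 < k)%N)
    (T : (pt (prod_var W (affine_line K)) ->
          pt (prod_var W (affine_line K))) -> Prop)
    (Ttorus : torus T)
    (Tinv : torus_invariant T (alpha_zk_1 alpha k))
    (Tmax : ~ exists That lambda,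
        [/\ torus That, torus_proper T That,
            semi_invariant That (alpha_zk_1 alpha k) lambda
          & ~ trivial_on That lambda])
    (m : nat) (m_gt0 : (0 < m)%N)
    (ks : m.-tuple nat) (ks_gt0 : forall i, (0 < tnth ks i)%N) :
  let X := prod_var (susp (alpha_zk_1 alpha k) [tuple of 1%N :: ks])
                    (affine_line K) in
  exists TT : nat -> (pt X -> pt X) -> Prop,
    (forall i, maximal_torus (TT i)) /\
    (forall i j, i <> j -> ~ conjugate (TT i) (TT j)).
Proof.
move=> X; set V := prod_var W (affine_line K); set f := alpha_zk_1 alpha k.
have domV : domain V := domain_line charK0 Wirr.
have f_reg : regular_fun f.
  apply: regD; last exact: reg_cst.
  apply: regM; first exact: (reg_comp (regmap_l W _) alpha_reg).
  exact: regX (reg_comp (regmap_r W _) (reg_coord _ 0)).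
have [w alpha_w] := alpha_neq0.
have fv0 : f (mkV w 0) = 1.
  by rewrite /f fE expr0n eqn0Ngt k_gt0 mulr0 add0r.
have [z zk] := closed_root (- (alpha w)^-1) k_gt0.
have fv1 : f (mkV w z) = 0 by rewrite /f fE zk mulrN divff ?addNr.
have [d [T1 [rho [iso rho_inv T1_max]]]] : exists d T1 (rho : pt (Gm K d) -> pt V -> pt V),
  [/\ torus_iso T1 rho, forall t v, f (rho t v) = f v
    & forall That, torus That -> torus_sub T1 That ->
      (forall phi, That phi -> exists c, forall v, f (phi v) = c * f v) ->
      torus_sub That T1].
  apply: (maximal_invariant_torus charK0 domV f_reg fv0 Ttorus _ Tmax).
  move=> phi v Tphi; have [lambda [_ fE] triv] := Tinv.
  by rewrite [RHS](fE phi) // triv // mul1r.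
have tori N : exists (TN : (pt X -> pt X) -> Prop), (0 < N)%N ->
  maximal_torus TN /\ forall e, stabilizer_exponent TN e -> (N %| e)%N.
  case: N => [|N]; first by exists (fun=> True).
  pose l := [tuple of nseq m N.+1].
  have l_gt0 i : (0 < tnth l i)%N by rewrite tnth_nseq.
  have [g [h [gK hK rg rh]]] : isomorphic (suspline f l) X.
    apply: (isomorphic_trans (danielewski charK0 alpha_reg k_gt0 l_gt0)).
    exact: isomorphic_sym (danielewski charK0 alpha_reg k_gt0 ks_gt0).
  exists (transport g h (TZ (l := l) rho_inv)) => _; split.
    apply: maximal_torus_transport => //.
    have fv0' : f (mkV w 0) != 0 by rewrite fv0 oner_neq0.
    exact: (TZ_maximal charK0 domV f_reg m_gt0 l_gt0 iso rho_inv fv0' T1_max).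
  move=> e stab; apply: (stabilizer_exponent_dvd charK0 (Ordinal m_gt0) _ iso (f_inv := rho_inv) fv1) => //.
  apply: (stabilizer_exponent_transport hK gK) stab => phi.
  by rewrite /transport (_ : h \o _ \o g = phi) //;
     apply: functional_extensionality => x /=; rewrite !gK.
have [TN TNP] := choice _ tori.
have exps N : exists e : nat, (0 < N)%N -> (0 < e)%N /\ stabilizer_exponent (TN N) e.
  case: N => [|N]; first by exists 0%N.
  have [[torN _] _] := TNP N.+1 isT.
  by have [e e0 stab] := stabilizer_exponent_exists charK0 torN; exists e.
have [E EP] := choice _ exps.
have [N [N_gt0 NE]] := escaping_sequence E.
exists (fun i => TN (N i)); split=> [i|i j ij [g [h [_ gK hK T2E]]]].
  by have [] := TNP (N i) (N_gt0 i).
have not_dvd a b : (a < b)%N -> stabilizer_exponent (TN (N b)) (E (N a)) -> False.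
  move=> ab; have [_ dvdN] := TNP (N b) (N_gt0 b); move=> /dvdN.
  have [Ea _] := EP (N a) (N_gt0 a).
  by move=> /(dvdn_leq Ea); rewrite leqNgt NE.
have stabE a : stabilizer_exponent (TN (N a)) (E (N a)).
  by have [] := EP (N a) (N_gt0 a).
have [/not_dvd|/not_dvd|//] := ltngtP i j; apply.
  apply: (stabilizer_exponent_transport gK hK) (stabE i) => phi.
  rewrite T2E; split=> [[psi Tpsi ->]|Tphi].
    rewrite /transport (_ : h \o _ \o g = psi) //.
    by apply: functional_extensionality => x /=; rewrite !gK.
  by exists (h \o phi \o g) => //; apply: functional_extensionality => x /=; rewrite !hK.
apply: (stabilizer_exponent_transport hK gK) (stabE j) => phi.
rewrite /transport T2E; split=> [Tphi|[psi Tpsi]].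
  by exists phi.
move=> /(congr1 (fun chi => h \o chi \o g)) E'.
suff -> : phi = psi by [].
apply: functional_extensionality => x; have := congr1 (fun chi => chi x) E'.
by rewrite /= !gK.
Qed.
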